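(* Let $n$ be a non-negative (time-global) entropy solution of $$\partial_t n+\partial_x F(x,n)=0,\quad F(x,n)=(2x-x^2)n-n^2,\qquad x>0,\ t>0,\qquad F(x,n)\to 0 \text{ as } x\to\infty,$$ with initial data $n_0\in L^1([0,\infty))$. If $n_0$ is compactly supported and $N[n_0]>N[\hat n_0]$, where $\hat n_0(x)=(2x-x^2)_+$ and $N[f]=\int_0^\infty f(x)\,dx$, then there exists $T>0$ such that $$N[n(T,\cdot)]<N[n_0].$$ In this situation the Bose-Einstein condensate necessarily forms in finite time, i.e. there is a non-zero total out-flux $\int_0^T n(t,0)^2\,dt>0$ at $x=0$ by the finite time $T$.
   Context: Let $F(x,n)=(2x-x^2)n-n^2$ and write $F_x(x,k)=(2-2x)k$ for its partial derivative in $x$; $\operatorname{sign}(0)=0$; $a_+=\max(a,0)$. Note that $\hat n_0$ (with a hat) is the fixed function $(2x-x^2)_+$ on $[0,\infty)$, whereas $n_0$ is the initial data. Entropy solution. A function $n(t,x)$ is an entropy solution of $\partial_t n+\partial_xF(x,n)=0$ on $x>0$, $t\in(0,T)$, with boundary condition $F(x,n)\to0$ as $x\to\infty$, if: (i) $n\in L^1([0,T]\times[0,\infty))\cap L^1([0,T];L^2([0,\infty)))$ and for every $\phi\in C_c^\infty((0,T)\times(0,\infty))$, $\int_0^T\int_0^\infty \big(n\,\partial_t\phi+F(x,n)\,\partial_x\phi\big)\,dx\,dt=0$; (ii) for every $k\in\mathbb{R}$ and every non-negative $\phi\in C_c^\infty((0,T)\times(0,\infty))$, $$\int_0^T\int_0^\infty\Big[|n-k|\,\partial_t\phi+\operatorname{sign}(n-k)\big(F(x,n)-F(x,k)\big)\partial_x\phi-\operatorname{sign}(n-k)F_x(x,k)\,\phi\Big]dx\,dt\ge0;$$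 (iii) $\lim_{R\to\infty}\int_0^T|F(R,n(t,R))|\,dt=0$. It is time-global if this holds for every $T>0$. No boundary condition is imposed at $x=0$. Initial data $n_0$ means: $n\in C([0,T];L^1((0,\infty)))$ (after modification on a null set of times) with $n(0,\cdot)=n_0$. The value $n(t,R)$ for $R>0$ is understood as a trace from $x<R$, and $n(t,0)$ as the trace from $x>0$. The out-flux at $x=0$ at time $t$ is $-F(0,n(t,0))=n(t,0)^2$; any such out-flux is called a contribution to the Bose-Einstein condensate. *)

(* Defs.v *)
From HB Require Import structures.
From mathcomp Require Import all_boot all_order all_algebra.
From mathcomp Require Import all_classical all_reals all_analysis.

Set Implicit Arguments.
Unset Strict Implicit.
Unset Printing Implicit Defensive.

Import Order.TTheory GRing.Theory Num.Theory.
Import numFieldNormedType.Exports.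

Local Open Scope classical_set_scope.
Local Open Scope ring_scope.

Section kompaneets.
Context {R : realType}.
Implicit Types (x k T J : R) (n phi : R -> R -> R) (f g : R -> R).

Local Notation mu := (@lebesgue_measure R).

(* Space-time functions are curried, time first: [n t x]. *)

Definition flux x (y : R) : R := (2 * x - x ^+ 2) * y - y ^+ 2.

(* partial derivative of [flux] in its first argument *)
Definition flux_x x k : R := (2 - 2 * x) * k.

Definition hat_n0 x : R := Num.max (2 * x - x ^+ 2) 0.

Definition mass f : \bar R := (\int[mu]_(x in `[0%R, +oo[) (f x)%:E)%E.

Definition dt phi : R -> R -> R := fun t x => derive1 (phi ^~ x) t.
Definition dx phi : R -> R -> R := fun t x => derive1 (phi t) x.

Fixpoint Ck (j : nat) phi : Prop :=
  continuous (fun p : R * R => phi p.1 p.2) /\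
  if j is i.+1 then
    [/\ forall t x, derivable (phi ^~ x) t 1 /\ derivable (phi t) x 1,
        Ck i (dt phi) & Ck i (dx phi)]
  else True.

(* C_c^oo((0,T) x (0,oo)), as functions on the plane extended by 0 *)
Definition test_function T phi : Prop :=
  (forall j, Ck j phi) /\
  exists K : set (R * R),
    [/\ compact K, K `<=` `]0, T[ `*` `]0, +oo[ &
        forall t x, ~ K (t, x) -> phi t x = 0].

(* Strong trace of n on (0,T) along a one-sided filter G of x-neighbourhoods
   ([r^'-] for the trace at r from x < r, [r^'+] from x > r): [n(., x)] tends to
   g in L^2(0,T), for x along G outside a Lebesgue-null set.  The exponent 2 is
   what makes the flux, which is quadratic in n, pass to the trace in L^1. *)
Definition trace T n (G : set_system R) g : Prop :=
  measurable_fun `[0, T] g /\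
  forall e : R, 0 < e -> exists2 A : set R, G A &
    {ae mu, forall x, A x ->
      (\int[mu]_(t in `[0%R, T]) ((n t x - g t) ^+ 2)%:E < e%:E)%E}.

(* In the two test-function conditions the integrals are extended-real valued,
   with [+oo - oo = -oo] in the library.  Hence [= 0] in [weak_solution] also
   asserts integrability of the integrand; as n is integrable, letting phi vary
   makes [flux x n] locally integrable, so that the integrals in
   [entropy_inequalities] are then finite as well. *)
Definition weak_solution T n : Prop :=
  forall phi, test_function T phi ->
    (\int[mu \x mu]_(p in `[0%R, T] `*` `[0%R, +oo[)
       (n p.1 p.2 * dt phi p.1 p.2 +
        flux p.2 (n p.1 p.2) * dx phi p.1 p.2)%:E = 0)%E.

Definition entropy_inequalities T n : Prop :=
  forall k phi, test_function T phi -> (forall t x, 0 <= phi t x) ->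
    (0 <= \int[mu \x mu]_(p in `[0%R, T] `*` `[0%R, +oo[)
       (`|n p.1 p.2 - k| * dt phi p.1 p.2
        + Num.sg (n p.1 p.2 - k) * (flux p.2 (n p.1 p.2) - flux p.2 k)
          * dx phi p.1 p.2
        - Num.sg (n p.1 p.2 - k) * flux_x p.2 k * phi p.1 p.2)%:E)%E.

(* [g r] is the trace [n(., r)] from [x < r]. *)
Definition flux_vanishes_at_infinity T n : Prop :=
  exists g : R -> R -> R,
    (\forall r \near +oo, trace T n r^'- (g r)) /\
    (\int[mu]_(t in `[0%R, T]) (`|flux r (g r t)|)%:E)%E @[r --> +oo] --> 0%E.

Definition entropy_solution T n : Prop :=
  [/\ (mu \x mu)%E.-integrable (`[0, T] `*` `[0, +oo[)
        (fun p => (n p.1 p.2)%:E),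
      (\int[mu]_(t in `[0%R, T])
         sqrte (\int[mu]_(x in `[0%R, +oo[) (n t x ^+ 2)%:E) < +oo)%E,
      weak_solution T n,
      entropy_inequalities T n &
      flux_vanishes_at_infinity T n].

Definition global_entropy_solution n : Prop :=
  forall T, 0 < T -> entropy_solution T n.

(* [n] itself is the representative that is continuous in time with values in
   L^1, so that [n t] is meaningful for every single t. *)
Definition initial_data n f : Prop :=
  [/\ forall t, 0 <= t -> mu.-integrable `[0, +oo[ (EFin \o n t),
      forall t, 0 <= t ->
        (\int[mu]_(x in `[0%R, +oo[) (`|n s x - n t x|)%:E)%E
          @[s --> within [set s | 0 <= s] (nbhs t)] --> 0%E &
      {ae mu, forall x, 0 <= x -> n 0 x = f x}].

Definition compactly_supported f : Prop :=
  exists K : set R, [/\ compact K, K `<=` `[0, +oo[ &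
    {ae mu, forall x, 0 <= x -> ~ K x -> f x = 0}].

(* The total out-flux through x = 0 on [0,T], i.e. the essential limit as
   x -> 0+ of the integral over [0,T] of [- flux x (n t x)], exists and is J. *)
Definition total_outflux T n J : Prop :=
  forall e : R, 0 < e -> exists2 A : set R, 0^'+ A &
    {ae mu, forall x, A x ->
      (`|\int[mu]_(t in `[0%R, T]) (- flux x (n t x))%:E - J%:E| < e%:E)%E}.

End kompaneets.

(* Main.v *)
(* Integrating the conservation law over [0, T] x (x, oo) gives, for almost
   every x > 0,
     int_0^T F(x, n(t, x)) dt = int_x^oo n(T) - int_x^oo n_0 >= - N[n_0],
   the flux at infinity being zero.  As F(x, .) is concave, Jensen's inequality
   turns this into a bound on the time average m(x) of n(., x):
     m(x) ^ 2 - (2 x - x ^ 2) m(x) <= N[n_0] / T,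
   so that m exceeds hat_n0 by at most O(T^(-1/2)) on bounded sets and by
   O(1 / (T x ^ 2)) at infinity, whence N[m] <= N[hat_n0] + o(1).  But N[m] is
   the time average of N[n(t)], so the mass cannot stay above
   N[n_0] > N[hat_n0].  Letting x tend to 0 in the identity, the mass lost is
   the out-flux.

   The identity follows from the weak formulation with products of cutoffs in
   time and space: first the space cutoffs tend to indicators, at Lebesgue
   points of the time-integrated flux, then the right end of the interval goes
   to infinity, and last the time cutoff tends to 1. *)

Require Import Defs.
From HB Require Import structures.
From mathcomp Require Import all_boot all_order all_algebra.
From mathcomp Require Import all_classical all_reals all_analysis.
From mathcomp Require Import measurable_realfun.
From mathcomp Require Import ring lra.

Set Implicit Arguments.
Unset Strict Implicit.
Unset Printing Implicit Defensive.

Import Order.TTheory GRing.Theory Num.Theory.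
Import numFieldNormedType.Exports.

Local Open Scope classical_set_scope.
Local Open Scope ring_scope.

(** * Smooth cutoffs *)

Section smooth_functions.
Context {R : realType}.
Implicit Types (f g a b : R -> R) (x : R).

(* The factors [x ^- k] close this family under differentiation. *)
Definition flat (k : nat) x : R := if 0 < x then x^-1 ^+ k * expR (- x^-1) else 0.

Lemma flat_ge0 k x : 0 <= flat k x.
Proof.
rewrite /flat; case: ifP => // x0.
by rewrite mulr_ge0 ?expR_ge0// exprn_ge0// invr_ge0 ltW.
Qed.

Lemma flat_le k x : 0 < x -> flat k x <= (k.+2)`!%:R * x ^+ 2.
Proof.
move=> x0; rewrite /flat x0 expRN ler_pdivrMr ?expR_gt0//.
have /(expR_ge1Dxn k.+1) : 0 <= x^-1 by rewrite invr_ge0 ltW.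
have : 0 < (k.+2)`!%:R :> R by rewrite ltr0n fact_gt0.
set F := _%:R => F0 h0.
have h : x^-1 ^+ k.+2 <= F * expR x^-1.
  by rewrite mulrC -ler_pdivrMr//; apply: le_trans h0; rewrite lerDr.
rewrite mulrAC -ler_pdivrMr ?exprn_gt0// (le_trans _ h)//.
by rewrite -exprVn -exprD addn2.
Qed.

Lemma is_derive_flat k x :
  is_derive x 1 (flat k) (- k%:R * flat k.+1 x + flat k.+2 x).
Proof.
have [x0|x0|->] := ltgtP x 0.
- rewrite /flat !ltNge !(ltW x0)/= mulr0 addr0.
  apply: (@near_eq_is_derive _ _ _ (cst 0)).
  by near=> y; rewrite ltNge ltW//=; near: y; exact: lt_nbhsl.
- apply: (@near_eq_is_derive _ _ _ (fun y : R => y^-1 ^+ k * expR (- y^-1))).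
    near=> y; rewrite /flat ifT//; near: y; exact: lt_nbhsr.
  have dV : is_derive x 1 (fun y : R => y^-1) (- x ^- 2).
    have := @is_deriveV R id x 1 1 (lt0r_neq0 x0) (is_derive_id _ _).
    by rewrite /= /GRing.scale/= mulr1.
  have dX : is_derive x 1 (fun y : R => y^-1 ^+ k) (- k%:R * x^-1 ^+ k.+1).
    have := is_deriveX k dV; rewrite exprfctE => h; apply: (is_derive_eq h).
    rewrite /GRing.scale/=; case: k {h} => [|k]; first by rewrite !mul0r oppr0 mul0r.
    by rewrite -exprVn !exprS; ring.
  have dE : is_derive x 1 (fun y : R => expR (- y^-1)) (expR (- x^-1) * x ^- 2).
    have d1 := @is_deriveN _ _ _ _ _ _ _ dV.
    have := @is_derive1_comp R expR _ x _ _ (is_derive_expR _) d1.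
    by rewrite opprK.
  apply: (is_derive_eq (is_deriveM dX dE)).
  by rewrite /GRing.scale/= /flat x0 -exprVn !exprS; ring.
- rewrite /flat !ltxx mulr0 addr0.
  have flat0 : flat k 0 = 0 by rewrite /flat ltxx.
  have cv : (h^-1 *: (flat k (h *: 1 + 0) - flat k 0)) @[h --> 0^'] --> 0.
    apply/cvgrPdist_le => e e0; near=> h; rewrite sub0r normrN flat0 subr0 addr0.
    rewrite /GRing.scale/= mulr1.
    have [h0|h0] := ltP 0 h; last by rewrite /flat ltNge h0/= mulr0 normr0 ltW.
    rewrite ger0_norm ?mulr_ge0 ?flat_ge0 ?invr_ge0 ?(ltW h0)// mulrC ler_pdivrMr//.
    rewrite (le_trans (flat_le k h0))// expr2 mulrA ler_pM2r// mulrC.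
    rewrite -ler_pdivlMr ?ltr0n ?fact_gt0//.
    rewrite -[X in X <= _](gtr0_norm h0); near: h; apply: dnbhs0_le.
    by rewrite divr_gt0// ltr0n fact_gt0.
  by apply: DeriveDef; [apply/cvg_ex; exists 0|apply/cvg_lim].
Unshelve. all: end_near. Qed.

Inductive smooth : (R -> R) -> Prop :=
| smooth_flat k : smooth (flat k)
| smooth_cst c : smooth (cst c)
| smooth_id : smooth id
| smoothD f g : smooth f -> smooth g -> smooth (fun x => f x + g x)
| smoothM f g : smooth f -> smooth g -> smooth (fun x => f x * g x)
| smooth_comp f g : smooth f -> smooth g -> smooth (f \o g)
| smoothV f : (forall x, f x != 0) -> smooth f -> smooth (fun x => (f x)^-1).

Lemma smooth_derive f : smooth f ->
  exists2 g, smooth g & forall x, is_derive x 1 f (g x).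
Proof.
elim=> {f} [k|c||f g sf [f' sf' ff'] sg [g' sg' gg']
  |f g sf [f' sf' ff'] sg [g' sg' gg']|f g sf [f' sf' ff'] sg [g' sg' gg']
  |f f0 sf [f' sf' ff']].
- exists (fun x => - k%:R * flat k.+1 x + flat k.+2 x).
    by apply: smoothD; [apply: smoothM; [exact: smooth_cst|]|]; exact: smooth_flat.
  exact: is_derive_flat.
- by exists (cst 0) => [|x]; [exact: smooth_cst|exact: is_derive_cst].
- by exists (cst 1) => [|x]; [exact: smooth_cst|exact: is_derive_id].
- by exists (fun x => f' x + g' x) => [|x]; [exact: smoothD|exact: is_deriveD].
- exists (fun x => f x * g' x + g x * f' x) => [|x]; last exact: is_deriveM.
  by apply: smoothD; exact: smoothM.
- exists (fun x => f' (g x) * g' x) => [|x]; last exact: is_derive1_comp.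
  by apply: smoothM => //; exact: smooth_comp.
- exists (fun x => (- 1 * ((f x)^-1 * (f x)^-1)) * f' x) => [|x].
    apply: smoothM => //; apply: smoothM; first exact: smooth_cst.
    by apply: smoothM; exact: smoothV.
  apply: (is_derive_eq (is_deriveV (f0 x) (ff' x))).
  by rewrite /GRing.scale/= expr2 invfM mulN1r.
Qed.

Lemma smooth_derivable f x : smooth f -> derivable f x 1.
Proof. by case/smooth_derive => g _ fg; exact: ex_derive. Qed.

Lemma smooth_continuous f : smooth f -> continuous f.
Proof.
by move=> sf x; apply/differentiable_continuous/derivable1_diffP/smooth_derivable.
Qed.

Lemma smooth_derive1 f : smooth f -> smooth (derive1 f).
Proof.
case/smooth_derive => g sg fg; suff -> : derive1 f = g by [].
by apply/funext => x; rewrite derive1E; exact: derive_val.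
Qed.

Lemma Ck_prod j a b : smooth a -> smooth b -> Ck j (fun t x => a t * b x).
Proof.
elim: j a b => [|j ih] a b sa sb.
all: have cab : continuous (fun p : R * R => a p.1 * b p.2).
1,3: move=> p; apply: (@cvgM _ _ _ _ (a \o fst) (b \o snd));
  apply: continuous_comp; [exact: cvg_fst|exact: smooth_continuous
                           |exact: cvg_snd|exact: smooth_continuous].
  by split.
have dtE (t x : R) : is_derive t 1 (fun t : R => a t * b x) (derive1 a t * b x).
  have [a' sa' aa'] := smooth_derive sa.
  apply: (is_derive_eq (is_deriveM (aa' t) (is_derive_cst (b x) t 1))).
  rewrite /GRing.scale/= mulr0 add0r mulrC derive1E; congr (_ * _).
  by apply/esym; exact: derive_val.
have dxE (t x : R) : is_derive x 1 (fun x : R => a t * b x) (a t * derive1 b x).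
  have [b' sb' bb'] := smooth_derive sb.
  apply: (is_derive_eq (is_deriveZ (a t) (bb' x))).
  by rewrite /GRing.scale/= derive1E; congr (_ * _); apply/esym; exact: derive_val.
split=> //; split=> [t x||].
- by split; exact: ex_derive.
- rewrite (_ : dt _ = fun t x => derive1 a t * b x).
    by apply: ih => //; exact: smooth_derive1.
  by apply/funext => t; apply/funext => x; rewrite /dt derive1E; exact: derive_val.
- rewrite (_ : dx _ = fun t x => a t * derive1 b x).
    by apply: ih => //; exact: smooth_derive1.
  by apply/funext => t; apply/funext => x; rewrite /dx derive1E; exact: derive_val.
Qed.

Lemma dt_prod a b t x : smooth a ->
  dt (fun t x => a t * b x) t x = derive1 a t * b x.
Proof.
case/smooth_derive => a' sa' aa'.
have h := is_deriveM (aa' t) (is_derive_cst (b x) t 1).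
rewrite /dt !derive1E (@derive_val _ _ _ _ _ _ _ (aa' t)).
by rewrite (@derive_val _ _ _ _ _ _ _ h) /GRing.scale/= mulr0 add0r mulrC.
Qed.

Lemma dx_prod a b t x : smooth b ->
  dx (fun t x => a t * b x) t x = a t * derive1 b x.
Proof.
case/smooth_derive => b' sb' bb'; have h := is_deriveZ (a t) (bb' x).
by rewrite /dx !derive1E (@derive_val _ _ _ _ _ _ _ (bb' x)) (@derive_val _ _ _ _ _ _ _ h).
Qed.

Lemma test_function_prod a b (T s t c d : R) : smooth a -> smooth b ->
  0 < s -> t < T -> (forall u, u \notin `[s, t] -> a u = 0) ->
  0 < c -> (forall x, x \notin `[c, d] -> b x = 0) ->
  test_function T (fun t x => a t * b x).
Proof.
move=> sa sb s0 tT aE c0 bE; split; first by move=> j; exact: Ck_prod.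
exists (`[s, t] `*` `[c, d]); split.
- by apply: compact_setX; exact: segment_compact.
- move=> [u x]/= [] /=; rewrite !in_itv/= => /andP[su ut] /andP[cx xd].
  by rewrite (lt_le_trans s0)// (le_lt_trans ut)// (lt_le_trans c0).
- move=> u x /not_andP[] /negP h; first by rewrite aE ?mul0r.
  by rewrite bE ?mulr0.
Qed.

Definition step x : R := flat 0 x / (flat 0 x + flat 0 (1 - x)).

Lemma flat0_gt0 x : 0 < x -> 0 < flat 0 x.
Proof. by move=> x0; rewrite /flat x0 expr0 mul1r expR_gt0. Qed.

Lemma step_den_gt0 x : 0 < flat 0 x + flat 0 (1 - x).
Proof.
have [x0|x0] := ltP 0 x.
  by rewrite ltr_pwDl ?flat0_gt0 ?flat_ge0.
by rewrite ltr_wpDl ?flat_ge0// flat0_gt0// subr_gt0 (le_lt_trans x0).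
Qed.

Lemma smooth_onem : smooth (fun x => 1 - x).
Proof.
rewrite (_ : (fun x => _) = (fun x => 1 + (- 1) * x)); last first.
  by apply/funext => x; rewrite mulN1r.
apply: smoothD; first exact: smooth_cst.
by apply: smoothM; [exact: smooth_cst|exact: smooth_id].
Qed.

Lemma smooth_step : smooth step.
Proof.
apply: smoothM; first exact: smooth_flat.
apply: smoothV => [x|]; first by rewrite gt_eqF// step_den_gt0.
apply: smoothD; first exact: smooth_flat.
by apply: (@smooth_comp (flat 0)); [exact: smooth_flat|exact: smooth_onem].
Qed.

Lemma step_le0 x : x <= 0 -> step x = 0.
Proof. by move=> x0; rewrite /step /flat ltNge x0 mul0r. Qed.

Lemma step_ge1 x : 1 <= x -> step x = 1.
Proof.
move=> x1; rewrite /step {3}/flat subr_gt0 ltNge x1 addr0 divff// gt_eqF//.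
by rewrite flat0_gt0// (lt_le_trans _ x1).
Qed.

Lemma step_ge0 x : 0 <= step x.
Proof. by rewrite divr_ge0 ?flat_ge0// ltW// step_den_gt0. Qed.

Lemma step_le1 x : step x <= 1.
Proof. by rewrite ler_pdivrMr ?step_den_gt0// mul1r lerDl flat_ge0. Qed.

Lemma derive1_step_out x : x \notin `[0, 1] -> derive1 step x = 0.
Proof.
rewrite in_itv/= negb_and -!ltNge => /orP[x0|x1]; rewrite derive1E.
- rewrite (@near_eq_derive _ _ _ _ (cst (0:R))) ?derive_cst ?oner_neq0//.
  by near=> y; rewrite step_le0// ltW//; near: y; exact: lt_nbhsl.
- rewrite (@near_eq_derive _ _ _ _ (cst (1:R))) ?derive_cst ?oner_neq0//.
  by near=> y; rewrite step_ge1// ltW//; near: y; exact: lt_nbhsr.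
Unshelve. all: end_near. Qed.

Lemma derive1_step_bounded : exists2 C, 0 < C & forall x, `|derive1 step x| <= C.
Proof.
have [||c _ hc] := @EVT_max R (fun x => `|derive1 step x|) 0 1; first by [].
  apply: continuous_subspaceT => x; apply: continuous_comp.
    by apply: smooth_continuous; exact/smooth_derive1/smooth_step.
  exact: norm_continuous.
exists (`|derive1 step c| + 1) => [|x]; first by rewrite ltr_wpDl.
have [x01|x01] := boolP (x \in `[0, 1]).
  by rewrite (le_trans (hc _ x01))// lerDl.
by rewrite derive1_step_out// normr0 addr_ge0.
Qed.

Definition step_at (p d : R) x : R := step ((x - p) / d).

Lemma smooth_step_at p d : smooth (step_at p d).
Proof.
apply: (@smooth_comp step); first exact: smooth_step.
apply: smoothM; last exact: smooth_cst.
by apply: smoothD; [exact: smooth_id|exact: smooth_cst].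
Qed.

Lemma derive1_step_at p d x :
  derive1 (step_at p d) x = derive1 step ((x - p) / d) / d.
Proof.
have [h' _ hh'] := smooth_derive smooth_step.
have d1 : is_derive x 1 (fun y : R => (y - p) / d) d^-1.
  have h1 := is_deriveD (is_derive_id x 1) (is_derive_cst (- p) x 1).
  apply: (is_derive_eq (is_deriveM h1 (is_derive_cst d^-1 x 1))).
  by rewrite /GRing.scale/= mulr0 add0r addr0 mulr1.
rewrite !derive1E (@derive_val _ _ _ _ _ _ _ (hh' _)).
exact: (@derive_val _ _ _ _ _ _ _ (is_derive1_comp (hh' _) d1)).
Qed.

End smooth_functions.

(** * Integration *)

Section integration.
Context {R : realType}.
Local Notation mu := (@lebesgue_measure R).
Implicit Types (A B D E : set R).

Section any_measure.
Context d (X : measurableType d) (nu : {measure set X -> \bar R}).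
Implicit Types (f g : X -> R).

Lemma Rintegral_subset (D E : set X) f : E `<=` D ->
  (forall x, D x -> ~ E x -> f x = 0) ->
  Rintegral nu D f = Rintegral nu E f.
Proof.
move=> ED f0; rewrite Rintegral_mkcond [RHS]Rintegral_mkcond; congr Rintegral.
apply/funext => x; rewrite /patch.
have [xE|xE] := boolP (x \in E); first by rewrite mem_set//; exact/ED/set_mem.
by case: ifPn => // /set_mem xD; apply: f0 => //; move: xE; rewrite notin_setE.
Qed.

Lemma integrable_mulr (D : set X) (k : R) f : measurable D ->
  nu.-integrable D (EFin \o f) -> nu.-integrable D (EFin \o (fun x => k * f x)).
Proof. by move=> mD; exact: integrableZl. Qed.

Lemma integrable_addr (D : set X) f g : measurable D ->
  nu.-integrable D (EFin \o f) -> nu.-integrable D (EFin \o g) ->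
  nu.-integrable D (EFin \o (fun x => f x + g x)).
Proof. by move=> mD; exact: integrableD. Qed.

Lemma integrable_subr (D : set X) f g : measurable D ->
  nu.-integrable D (EFin \o f) -> nu.-integrable D (EFin \o g) ->
  nu.-integrable D (EFin \o (fun x => f x - g x)).
Proof. by move=> mD; exact: integrableB. Qed.

Lemma integrable_bounded_mul (D : set X) f g M : measurable D ->
  measurable_fun D f -> (forall x, D x -> `|f x| <= M) ->
  nu.-integrable D (EFin \o g) ->
  nu.-integrable D (EFin \o (fun x => f x * g x)).
Proof.
move=> mD mf fM ig; apply: (@integrableMr _ _ _ nu D mD f (EFin \o g)) => //.
exists M; split; first exact: num_real.
by move=> N MN x Dx; apply: le_trans (fM x Dx) (ltW MN).
Qed.

Lemma integrable_fine (g : X -> \bar R) : nu.-integrable setT g ->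
  nu.-integrable setT (EFin \o (fine \o g)).
Proof.
move=> ig; apply: le_integrable (ig) => //.
  apply/measurable_EFinP; apply: measurableT_comp (measurable_int _ ig).
  exact: fine_measurable.
by move=> x _ /=; case: (g x) => //=; rewrite normr0 leey.
Qed.

Lemma Rintegral_fine (g : X -> \bar R) : nu.-integrable setT g ->
  Rintegral nu setT (fine \o g) = fine (\int[nu]_x g x)%E.
Proof.
move=> ig; congr fine; apply: ae_eq_integral => //.
- exact: measurable_int (integrable_fine ig).
- exact: measurable_int ig.
- by have := integrable_ae measurableT ig; apply: filterS => x /(_ I) gx _; rewrite /= fineK.
Qed.

End any_measure.

Section fubini_rect.
Context d1 d2 (X : measurableType d1) (Y : measurableType d2).
Context (m1 : {sigma_finite_measure set X -> \bar R})
  (m2 : {sigma_finite_measure set Y -> \bar R}).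
Variables (A : set X) (B : set Y) (f : X * Y -> R).
Hypotheses (mA : measurable A) (mB : measurable B).
Hypothesis fAB : (m1 \x m2)%E.-integrable (A `*` B) (EFin \o f).

Let mAB : measurable (A `*` B). Proof. exact: measurableX. Qed.

Let h : X * Y -> \bar R := (EFin \o f) \_ (A `*` B).

Let ih : (m1 \x m2)%E.-integrable setT h.
Proof. exact/(integrable_mkcond _ mAB). Qed.

Let hE t x : h (t, x) =
  if (t \in A) && (x \in B) then (f (t, x))%:E else 0%E.
Proof.
rewrite /h /patch; congr (if _ then _ else _).
by apply/idP/andP => [/set_mem[]|[] /set_mem ? /set_mem ?]; rewrite !inE.
Qed.

Let F t : \bar R := (\int[m2]_x h (t, x))%E.
Let G x : \bar R := (\int[m1]_t h (t, x))%E.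

Let mG : measurable_fun setT G.
Proof. exact: (measurable_fubini_G ih). Qed.

Let iG : m2.-integrable setT G.
Proof.
apply/integrableP; split => //.
have := (integrable21ltyP m1 m2 (measurable_int _ ih)).1 ih.
apply: le_lt_trans; apply: ge0_le_integral => //.
- exact: measurableT_comp.
- apply: (@measurable_fun_fubini_tonelli_G _ _ _ _ _ _ (abse \o h)).
    by apply: measurableT_comp => //; exact: (measurable_int _ ih).
  by move=> x; exact: abse_ge0.
- move=> x _; apply: le_abse_integral => //.
  by apply: measurableT_comp; [exact: measurable_int ih|exact: pair2_measurable].
Qed.

Let FE : (fun t => \int[m2]_(x in B) f (t, x)) \_ A = fine \o F.
Proof.
apply/funext => t /=; rewrite patchE /F; case: ifPn => tA.
  rewrite /Rintegral integral_mkcond; congr fine; apply: eq_integral => x _.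
  by rewrite hE patchE tA.
by rewrite integral0_eq// => x _; rewrite hE (negbTE tA).
Qed.

Let GE : (fun x => \int[m1]_(t in A) f (t, x)) \_ B = fine \o G.
Proof.
apply/funext => x /=; rewrite patchE /G; case: ifPn => xB.
  rewrite /Rintegral integral_mkcond; congr fine; apply: eq_integral => t _.
  by rewrite hE patchE xB andbT.
by rewrite integral0_eq// => t _; rewrite hE (negbTE xB) andbF.
Qed.

Lemma fubini_ae_integrable2 :
  {ae m2, forall x, B x -> m1.-integrable A (fun t => (f (t, x))%:E)}.
Proof.
have := ae_integrable2 ih; apply: filterS => x ix Bx.
apply/integrable_mkcond => //; move: ix; congr integrable.
by apply/funext => t; rewrite hE patchE [x \in B]mem_set// andbT.
Qed.

Lemma fubini_integrable2 :
  m2.-integrable B (fun x => (\int[m1]_(t in A) f (t, x))%:E).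
Proof.
apply/integrable_mkcond => //; have := integrable_fine iG; rewrite -GE.
by congr integrable; apply/funext => x; rewrite /= !patchE; case: ifP.
Qed.

Lemma fubini_Rintegral2 : Rintegral (m1 \x m2)%E (A `*` B) f =
  \int[m2]_(x in B) \int[m1]_(t in A) f (t, x).
Proof.
rewrite [RHS]Rintegral_mkcond GE Rintegral_fine// /Rintegral integral_mkcond.
by rewrite -(integral21_prod_meas1 ih).
Qed.

Lemma fubini_Rintegral1 : Rintegral (m1 \x m2)%E (A `*` B) f =
  \int[m1]_(t in A) \int[m2]_(x in B) f (t, x).
Proof.
rewrite [RHS]Rintegral_mkcond FE Rintegral_fine; last exact: integrable_fubini_F.
by rewrite /Rintegral integral_mkcond -(integral12_prod_meas1 ih).
Qed.

End fubini_rect.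

End integration.

Section integral_limits.
Context {R : realType}.

Section any_measure.
Context d (X : measurableType d) (nu : {measure set X -> \bar R}).
Implicit Types (D : set X) (f g : X -> R).

Lemma ae_eq_Rintegral D f g : measurable D ->
  nu.-integrable D (EFin \o f) -> nu.-integrable D (EFin \o g) ->
  {ae nu, forall x, D x -> f x = g x} ->
  Rintegral nu D f = Rintegral nu D g.
Proof.
move=> mD iF iG fg; congr fine; apply: ae_eq_integral => //.
- exact: measurable_int iF.
- exact: measurable_int iG.
- by apply: filterS fg => x fgx Dx; rewrite fgx.
Qed.

Lemma Rintegral_dominated D (f_ : nat -> X -> R) f g : measurable D ->
  (forall k, measurable_fun D (f_ k)) ->
  (forall x, D x -> f_ ^~ x @ \oo --> f x) ->
  nu.-integrable D (EFin \o g) ->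
  (forall k x, D x -> `|f_ k x| <= g x) ->
  nu.-integrable D (EFin \o f) /\
  Rintegral nu D (f_ k) @[k --> \oo] --> Rintegral nu D f.
Proof.
move=> mD mf_ f_f ig fg.
have mf : measurable_fun D f by exact: measurable_fun_cvg mf_ f_f.
have [|||||iF _ cF] := @dominated_convergence _ X R nu D mD
    (fun k => EFin \o f_ k) (EFin \o f) (EFin \o g).
- by move=> k; exact/measurable_EFinP.
- exact/measurable_EFinP.
- by apply: nearW => x Dx; apply: cvg_EFin; [exact: nearW|exact: f_f].
- exact: ig.
- by apply: nearW => x k Dx; rewrite /= lee_fin fg.
by split => //; apply: fine_cvg; rewrite fineK ?integrable_fin_num.
Qed.

Lemma Rintegral_fatou D (f_ : nat -> X -> R) f (M : R) : measurable D ->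
  (forall k, nu.-integrable D (EFin \o f_ k)) ->
  (forall k x, D x -> 0 <= f_ k x) ->
  (forall x, D x -> f_ ^~ x @ \oo --> f x) ->
  (forall k, Rintegral nu D (f_ k) <= M) ->
  nu.-integrable D (EFin \o f).
Proof.
move=> mD if_ f_ge0 f_f f_le.
have mf_ k : measurable_fun D (f_ k) by apply/measurable_EFinP; exact: measurable_int (if_ k).
have mf : measurable_fun D f by exact: measurable_fun_cvg mf_ f_f.
apply/integrableP; split; first exact/measurable_EFinP.
have -> : (\int[nu]_(x in D) `|(EFin \o f) x| =
    \int[nu]_(x in D) limn_einf (fun k => (f_ k x)%:E))%E.
  apply: eq_integral => x /set_mem Dx; have cf := f_f x Dx.
  have f0 : 0 <= f x.
    rewrite -(cvg_lim _ cf)//; apply: limr_ge; first by apply/cvg_ex; exists (f x).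
    by apply: nearW => k; exact: f_ge0.
  rewrite /= ger0_norm//; apply/esym; apply: (cvg_limn_einf_sup _).1.
  by apply: cvg_EFin; [exact: nearW|exact: cf].
apply: (@le_lt_trans _ _ M%:E); last exact: ltry.
have mf_E k : measurable_fun D (EFin \o f_ k) by exact/measurable_EFinP.
have f_E k x : D x -> (0 <= (EFin \o f_ k) x)%E by move=> Dx; rewrite lee_fin f_ge0.
apply: le_trans (fatou nu mD mf_E f_E) _.
rewrite limn_einf_lim; apply: lime_le; first exact: is_cvg_einfs.
apply: nearW => k; apply: (@le_trans _ _ (\int[nu]_(x in D) (f_ k x)%:E)%E).
  by apply: ereal_inf_lbound; exists k => /=.
by rewrite -(fineK (integrable_fin_num mD (if_ k))) lee_fin; exact: f_le.
Qed.

End any_measure.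
Section weights.
Context d1 d2 (X : measurableType d1) (Y : measurableType d2).
Context (m1 : {sigma_finite_measure set X -> \bar R})
  (m2 : {sigma_finite_measure set Y -> \bar R}).
Variables (A : set X) (B : set Y) (f : X * Y -> R).
Hypotheses (mA : measurable A) (mB : measurable B).
Hypothesis fAB : (m1 \x m2)%E.-integrable (A `*` B) (EFin \o f).

Lemma integrable_weight2 (w : Y -> R) (M : R) :
  measurable_fun setT w -> (forall x, `|w x| <= M) ->
  (m1 \x m2)%E.-integrable (A `*` B) (EFin \o (fun p => w p.2 * f p)).
Proof.
move=> mw wM; apply: (@integrable_bounded_mul _ _ _ _ _ _ _ M) => //.
- exact: measurableX.
- by apply: measurable_funTS; apply: measurableT_comp mw _; exact: measurable_snd.
Qed.

Lemma integrable_weight1 (w : X -> R) (M : R) :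
  measurable_fun setT w -> (forall x, `|w x| <= M) ->
  (m1 \x m2)%E.-integrable (A `*` B) (EFin \o (fun p => w p.1 * f p)).
Proof.
move=> mw wM; apply: (@integrable_bounded_mul _ _ _ _ _ _ _ M) => //.
- exact: measurableX.
- by apply: measurable_funTS; apply: measurableT_comp mw _; exact: measurable_fst.
Qed.

Lemma fubini_weight2 (w : Y -> R) (M : R) :
  measurable_fun setT w -> (forall x, `|w x| <= M) ->
  Rintegral (m1 \x m2)%E (A `*` B) (fun p => w p.2 * f p) =
  \int[m2]_(x in B) (w x * \int[m1]_(t in A) f (t, x)).
Proof.
move=> mw wM; have iw := integrable_weight2 mw wM.
rewrite (fubini_Rintegral2 mA mB iw); apply: ae_eq_Rintegral => //.
- exact: (fubini_integrable2 mA mB iw).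
- apply: (@integrable_bounded_mul _ _ _ _ _ _ _ M) => //.
    exact: measurable_funTS.
  exact: (fubini_integrable2 mA mB fAB).
- have := fubini_ae_integrable2 mA mB fAB; apply: filterS => x ix Bx /=.
  by rewrite RintegralZl//; exact: ix.
Qed.

End weights.

Lemma harmonic_at_right (a : R) : 0 < a -> a / k.+1%:R @[k --> \oo] --> (0 : R)^'+.
Proof.
move=> a0 P [e /= e0 eP].
have : a / k.+1%:R @[k --> \oo] --> 0.
  by rewrite -(mulr0 a); apply: cvgM; [exact: cvg_cst|exact: cvg_harmonic].
move/cvgrPdist_lt => /(_ _ e0); apply: filterS => k ke.
by apply: eP => //; rewrite divr_gt0.
Qed.

Lemma cvg_at_right_seq (a : R) (f : R -> R) (l : R) : 0 < a ->
  f h @[h --> 0^'+] --> l -> f (a / k.+1%:R) @[k --> \oo] --> l.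
Proof. by move=> a0; apply: cvg_comp; exact: harmonic_at_right. Qed.

Local Notation mu := (@lebesgue_measure R).

Lemma cvg_Rintegral_tail (g : R -> R) (x : R) (y : nat -> R) :
  mu.-integrable `]x, +oo[ (EFin \o g) ->
  (forall k, x < y k) -> y k @[k --> \oo] --> +oo ->
  \int[mu]_(z in `]x, y k]) g z @[k --> \oo] --> \int[mu]_(z in `]x, +oo[) g z.
Proof.
move=> ig xy yoo.
pose g_ k := g \_ `]x, y k].
have sub k : `]x, y k] `<=` `]x, +oo[.
  by move=> z /=; rewrite !in_itv/= andbT => /andP[].
have mg : measurable_fun `]x, +oo[ g by apply/measurable_EFinP; exact: measurable_int ig.
have -> : (fun k => \int[mu]_(z in `]x, y k]) g z) =
    (fun k => \int[mu]_(z in `]x, +oo[) g_ k z).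
  apply/funext => k; rewrite -Rintegral_mkcondr; congr Rintegral.
  by apply/esym/setIidPr; exact: sub.
have [||||| _ h] := @Rintegral_dominated _ _ mu `]x, +oo[%classic g_ g (fun z => `|g z|).
- exact: measurable_itv.
- move=> k; apply/measurable_restrict => //.
  by apply: measurable_funS mg => // z [].
- move=> z; rewrite /= in_itv/= andbT => xz; apply: cvg_near_cst.
  move/cvgryPge : yoo => /(_ z); apply: filterS => k zy.
  by rewrite /g_ patchE mem_set//= in_itv/= xz.
- exact: integrable_norm.
- by move=> k z _; rewrite /g_ patchE; case: ifP => _ //=; rewrite normr0.
exact: h.
Qed.

End integral_limits.

(** * Approximation of the identity *)

Section approximate_identity.
Context {R : realType}.
Local Notation mu := (@lebesgue_measure R).
Implicit Types (u f : R -> R) (p d c x T : R).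

Lemma continuous_integrable_itv f a b : continuous f ->
  mu.-integrable `[a, b] (EFin \o f).
Proof.
move=> cf; apply: continuous_compact_integrable; first exact: segment_compact.
exact: continuous_subspaceT.
Qed.

Lemma continuous_measurable f (D : set R) : measurable D -> continuous f ->
  measurable_fun D f.
Proof. by move=> mD cf; apply: measurable_funTS; exact: continuous_measurable_fun. Qed.

Lemma smooth_FTC2 f a b : smooth f -> a < b ->
  \int[mu]_(x in `[a, b]) derive1 f x = f b - f a.
Proof.
move=> sf ab; rewrite /Rintegral.
rewrite (@continuous_FTC2 _ (derive1 f) f)//.
- exact/continuous_subspaceT/smooth_continuous/smooth_derive1.
- split; first by move=> x _; exact: smooth_derivable.
  + exact/cvg_at_right_filter/smooth_continuous.
  + exact/cvg_at_left_filter/smooth_continuous.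
Qed.

Lemma derive1_step_at_out p d x : 0 < d -> x \notin `[p, p + d] ->
  derive1 (step_at p d) x = 0.
Proof.
move=> d0 xpd; rewrite derive1_step_at derive1_step_out ?mul0r//.
apply: contra xpd; rewrite !in_itv/= pmulr_lge0 ?invr_gt0// subr_ge0.
by rewrite ler_pdivrMr// mul1r lerBlDl.
Qed.

Lemma measurable_derive1_step_at p d (D : set R) : measurable D ->
  measurable_fun D (derive1 (step_at p d)).
Proof.
move=> mD; apply: continuous_measurable => //.
exact/smooth_continuous/smooth_derive1/smooth_step_at.
Qed.

Lemma step_mean : exists2 C : R, 0 < C & forall u p d c, 0 < d ->
  mu.-integrable `[p, p + d] (EFin \o u) ->
  `|\int[mu]_(x in `[p, (p + d)%R]) (derive1 (step_at p d) x * u x) - c| <=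
  C / d * \int[mu]_(x in `[p, (p + d)%R]) `|u x - c|.
Proof.
have [C C0 hC] := @derive1_step_bounded R.
exists C => // u p d c d0 iu; set D := `[p, p + d]%classic.
have mD : measurable D by exact: measurable_itv.
have ic : mu.-integrable D (EFin \o cst c) by exact/continuous_integrable_itv/cst_continuous.
have iuc : mu.-integrable D (EFin \o (fun x => u x - c)) by exact: integrable_subr.
have hS x : `|derive1 (step_at p d) x| <= C / d.
  rewrite derive1_step_at normrM.
  by rewrite [`|d^-1|]gtr0_norm ?invr_gt0// ler_pM2r ?invr_gt0.
have iM (v : R -> R) : mu.-integrable D (EFin \o v) ->
    mu.-integrable D (EFin \o (fun x => derive1 (step_at p d) x * v x)).
  move=> iv; apply: (@integrable_bounded_mul _ _ _ _ _ _ _ (C / d)) => //.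
  exact: measurable_derive1_step_at.
have cE : c = \int[mu]_(x in D) (derive1 (step_at p d) x * c).
  rewrite RintegralZr//; last first.
    exact/continuous_integrable_itv/smooth_continuous/smooth_derive1/smooth_step_at.
  rewrite smooth_FTC2 ?ltrDl//; last exact: smooth_step_at.
  rewrite /step_at subrr mul0r addrAC subrr add0r divff ?gt_eqF//.
  by rewrite (step_le0 (lexx 0)) (step_ge1 (lexx 1)) subr0 mul1r.
rewrite [X in `|_ - X|]cE -RintegralB//; [|exact: iM|exact: (iM (cst c))].
rewrite -RintegralZl//; last exact: integrable_norm.
under eq_Rintegral do rewrite -mulrBr.
apply: (le_trans (@le_normr_Rintegral _ _ _ mu _ _ mD (iM _ iuc))).
apply: le_Rintegral => //.
- exact/integrable_norm/iM.
- by apply: integrable_mulr => //; exact: integrable_norm.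
- by move=> x _; rewrite normrM ler_wpM2r.
Qed.

Lemma near_at_right (a : R) (P : set R) : (\forall x \near a^'+, P x) ->
  exists2 e : R, 0 < e & forall h, 0 < h -> h < e -> P (a + h).
Proof.
case=> e /= e0 eP; exists e => // h h0 he; apply: eP; last by rewrite ltrDl.
by rewrite /= opprD addrA subrr add0r normrN gtr0_norm.
Qed.

Lemma at_right_near (a : R) (P : set R) (e : R) : 0 < e ->
  (forall h, 0 < h -> h < e -> P (a + h)) -> \forall x \near a^'+, P x.
Proof.
move=> e0 eP; exists e => //= x /= xa ax; rewrite -(subrK a x) addrC.
apply: eP; first by rewrite subr_gt0.
by move: xa; rewrite distrC gtr0_norm// subr_gt0.
Qed.

Lemma davg_lt f x r (e : R) : 0 < r -> (davg f x r < e%:E)%E ->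
  (\int[mu]_(y in ball x r) `|f y - f x|%:E < (r *+ 2 * e)%:E)%E.
Proof.
move=> r0; rewrite /davg /iavg lebesgue_measure_ball ?ltW//.
by rewrite inver gt_eqF ?mulrn_wgt0// EFinM lte_pdivrMl ?mulrn_wgt0.
Qed.

Lemma step_lebesgue_pt u c d x : mu.-integrable `[c, d] (EFin \o u) ->
  c < x < d -> lebesgue_pt (u \_ `[c, d]) x ->
  \int[mu]_(y in `[c, d]) (derive1 (step_at x h) y * u y) @[h --> 0^'+] --> u x.
Proof.
move=> iu /andP[cx xd] ux; set v := u \_ `[c, d].
have vE y : y \in `[c, d] -> v y = u y by move=> ycd; rewrite /v patchE mem_setE ycd.
have [C C0 hC] := step_mean.
apply/cvgrPdist_le => e e0.
have e'0 : 0 < e / (C * 4) by rewrite divr_gt0// mulr_gt0.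
have [/near_at_right[h1 h10 H1] /cvgrPdist_lt/(_ _ e'0)/near_at_right[h2 h20 H2]]
  := (fine_cvgP _ _).1 ux.
have dx0 : 0 < d - x by rewrite subr_gt0.
apply: (@at_right_near _ _ (Num.min (d - x) (Num.min (h1 / 2) (h2 / 2)))).
  by rewrite !lt_min dx0 !divr_gt0.
move=> h h0; rewrite !lt_min add0r => /andP[hd /andP[hh1 hh2]].
have h20' : 0 < h * 2 by rewrite mulr_gt0.
have xhcd : `[x, x + h] `<=` `[c, d].
  move=> y /=; rewrite !in_itv/= => /andP[xy yh].
  by rewrite (le_trans (ltW cx))//= (le_trans yh)// -lerBrDl ltW.
have {}H : (davg v x (h * 2) < (e / (C * 4))%:E)%E.
  have := H2 _ h20'; rewrite -ltr_pdivlMr// => /(_ hh2).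
  have := H1 _ h20'; rewrite -ltr_pdivlMr// => /(_ hh1).
  rewrite !add0r => hf; rewrite /= normrN => /(le_lt_trans (ler_norm _)).
  by rewrite -lte_fin fineK.
have iuh : mu.-integrable `[x, x + h] (EFin \o u).
  by apply: integrableS iu.
rewrite distrC (@Rintegral_subset _ _ _ mu _ `[x, x + h]%classic)//; last first.
  by move=> y _ yxh; rewrite derive1_step_at_out ?mul0r//; apply/negP.
apply: (le_trans (hC u x h (u x) h0 iuh)).
rewrite mulrAC ler_pdivrMr// mulrC -ler_pdivlMr//.
have iuxh : mu.-integrable `[x, x + h] (EFin \o (fun y => `|u y - u x|)).
  apply: integrable_norm; apply: integrable_subr => //.
  exact/continuous_integrable_itv/cst_continuous.
rewrite -lee_fin fineK; last exact: integrable_fin_num.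
have := davg_lt h20' H; rewrite vE ?in_itv/= ?(ltW cx) ?(ltW xd)// => /ltW.
rewrite (_ : h * 2 *+ 2 * (e / (C * 4)) = e * h / C); last first.
  by rewrite -mulr_natl; field; rewrite gt_eqF.
apply: le_trans; rewrite (@eq_integral _ _ _ mu _ (fun y => `|v y - u x|%:E)).
  apply: ge0_subset_integral => //; first exact: measurable_ball.
    apply/measurable_EFinP; apply: measurableT_comp => //.
    apply: measurable_funB => //.
    apply: measurable_funTS; apply/(measurable_restrictT _ _).1 => //.
    apply/measurable_EFinP; exact: (measurable_int mu iu).
  move=> y /=; rewrite in_itv/= => /andP[xy yh].
  rewrite -ball_normE/= distrC ger0_norm ?subr_ge0//.
  by rewrite ltrBlDl (le_lt_trans yh)// ltrD2l ltr_pMr// ltr1n.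
by move=> y /set_mem/xhcd yy; rewrite vE.
Qed.

End approximate_identity.

Section cutoff.
Context {R : realType}.
Local Notation mu := (@lebesgue_measure R).
Implicit Types (u f : R -> R) (p d c x T : R).

Lemma step_cvg u c d (p : R -> R) l : mu.-integrable `[c, d] (EFin \o u) ->
  (forall e, 0 < e -> \forall h \near 0^'+, `[p h, p h + h] `<=` `[c, d] /\
    forall y, y \in `[p h, p h + h] -> `|u y - l| <= e) ->
  \int[mu]_(y in `[c, d]) (derive1 (step_at (p h) h) y * u y) @[h --> 0^'+] --> l.
Proof.
move=> iu hl; have [C C0 hC] := @step_mean R.
apply/cvgrPdist_le => e e0.
have e'0 : 0 < e / C by rewrite divr_gt0.
have [h1 h10 H1] := near_at_right (hl _ e'0).
apply: (at_right_near h10) => h h0 hh1; rewrite add0r.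
have [pcd pl] := H1 h h0 hh1; rewrite !add0r in pcd pl.
have iuh : mu.-integrable `[p h, p h + h] (EFin \o u) by exact: integrableS iu.
have ic k : mu.-integrable `[p h, p h + h] (EFin \o cst k).
  exact/continuous_integrable_itv/cst_continuous.
rewrite distrC (@Rintegral_subset _ _ _ mu _ `[p h, p h + h]%classic)//; last first.
  by move=> y _ yxh; rewrite derive1_step_at_out ?mul0r//; apply/negP.
apply: (le_trans (hC u (p h) h l h0 iuh)).
rewrite mulrAC ler_pdivrMr// mulrC -ler_pdivlMr// mulrAC.
have -> : e / C * h = \int[mu]_(y in `[p h, (p h + h)%R]) (e / C).
  rewrite Rintegral_cst//= lebesgue_measure_itv/= lte_fin ltrDl h0 -EFinD/=.
  by rewrite addrAC subrr add0r.
apply: le_Rintegral => //; last exact: (ic (e / C)).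
by apply: integrable_norm; exact: (@integrable_subr _ _ _ mu _ u (cst l)).
Qed.

Definition cut (x y h : R) (z : R) := step_at x h z - step_at y h z.

Lemma smooth_cut x y h : smooth (cut x y h).
Proof.
rewrite (_ : cut x y h = fun z => step_at x h z + (- 1) * step_at y h z); last first.
  by apply/funext => z; rewrite mulN1r.
apply: smoothD; first exact: smooth_step_at.
by apply: smoothM; [exact: smooth_cst|exact: smooth_step_at].
Qed.

Lemma derive1_cut x y h z :
  derive1 (cut x y h) z = derive1 (step_at x h) z - derive1 (step_at y h) z.
Proof.
rewrite !derive1E.
by apply: deriveB; apply: smooth_derivable; exact: smooth_step_at.
Qed.

Lemma step_at_le0 p h z : 0 < h -> z <= p -> step_at p h z = 0.
Proof.
by move=> h0 zp; rewrite /step_at step_le0// pmulr_lle0 ?invr_gt0// subr_le0.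
Qed.

Lemma step_at_ge1 p h z : 0 < h -> p + h <= z -> step_at p h z = 1.
Proof.
by move=> h0 zp; rewrite /step_at step_ge1// ler_pdivlMr// mul1r lerBrDl.
Qed.

Lemma cut_out x y h z : 0 < h -> x + h <= y -> z \notin `[x, y + h] ->
  cut x y h z = 0.
Proof.
move=> h0 xy; rewrite in_itv/= negb_and -!ltNge => /orP[zx|yz]; rewrite /cut.
  by rewrite !step_at_le0 ?subrr// ?(ltW zx)// (le_trans (ltW zx))//; lra.
by rewrite !step_at_ge1 ?subrr// ?(ltW yz)//; lra.
Qed.

Lemma cut_in x y h z : 0 < h -> x + h <= z <= y -> cut x y h z = 1.
Proof.
by move=> h0 /andP[xz zy]; rewrite /cut step_at_ge1// step_at_le0// subr0.
Qed.

Lemma cut_itv01 x y h z : 0 < h -> x + h <= y -> 0 <= cut x y h z <= 1.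
Proof.
move=> h0 xy; rewrite /cut; have [zy|/ltW yz] := leP z y.
  by rewrite (step_at_le0 h0 zy) subr0 step_ge0 step_le1.
by rewrite [step_at x h z]step_at_ge1 ?(le_trans xy)// subr_ge0 step_le1 gerBl step_ge0.
Qed.

Lemma cvg_cut x y z : x < z <= y -> cut x y h z @[h --> 0^'+] --> (1 : R).
Proof.
move=> /andP[xz zy]; apply: cvg_near_cst.
apply: (@at_right_near _ _ _ (z - x)); first by rewrite subr_gt0.
by move=> h h0; rewrite add0r => hz; apply: cut_in => //; lra.
Qed.

Lemma cvg_cut_out x y z : x < y -> z <= x \/ y < z -> cut x y h z @[h --> 0^'+] --> (0 : R).
Proof.
move=> xy zxy; apply: cvg_near_cst; case: zxy => [zx|yz].
  apply: (@at_right_near _ _ _ 1) => // h h0 _; rewrite add0r /cut.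
  by rewrite !step_at_le0 ?subrr//; lra.
apply: (@at_right_near _ _ _ (z - y)); first by rewrite subr_gt0.
move=> h h0; rewrite !add0r => hz.
by rewrite /cut !step_at_ge1 ?subrr//; lra.
Qed.

(* Increases from 0 to 1 on [h, 2 h] and decreases back to 0 on
   [T - 2 h, T - h]. *)
Definition time_cut T h : R -> R := cut h (T - 2 * h) h.

Lemma cvg_time_cut T t : 0 < t < T -> time_cut T h t @[h --> 0^'+] --> (1 : R).
Proof.
move=> /andP[t0 tT]; apply: cvg_near_cst.
apply: (@at_right_near _ _ _ (Num.min (t / 2) ((T - t) / 2))).
  by rewrite lt_min !divr_gt0// subr_gt0.
move=> h h0; rewrite add0r lt_min => /andP[h1 h2].
by apply: cut_in => //; lra.
Qed.

Lemma cvg_derive1_time_cut T u : 0 < T -> mu.-integrable `[0, T] (EFin \o u) ->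
  u t @[t --> 0^'+] --> u 0 -> u t @[t --> T^'-] --> u T ->
  \int[mu]_(t in `[0, T]) (derive1 (time_cut T h) t * u t) @[h --> 0^'+]
    --> u 0 - u T.
Proof.
move=> T0 iu u0 uT.
have bS p h : 0 < h -> mu.-integrable `[0, T]
    (EFin \o (fun t => derive1 (step_at p h) t * u t)).
  move=> h0; have [C _ hC] := @derive1_step_bounded R.
  apply: (@integrable_bounded_mul _ _ _ _ _ _ _ (C / h)) => //.
    exact: measurable_derive1_step_at.
  move=> x _; rewrite derive1_step_at normrM.
  by rewrite [`|h^-1|]gtr0_norm ?invr_gt0// ler_pM2r ?invr_gt0.
suff : \int[mu]_(t in `[0, T]) (derive1 (step_at h h) t * u t) -
       \int[mu]_(t in `[0, T]) (derive1 (step_at (T - 2 * h) h) t * u t)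
         @[h --> 0^'+] --> u 0 - u T.
  apply: cvg_trans; apply: near_eq_cvg; apply: (@at_right_near _ _ _ 1) => // h h0 _.
  rewrite add0r -RintegralB//; [|exact: bS|exact: bS].
  by apply: eq_Rintegral => t _; rewrite /time_cut derive1_cut mulrBl.
apply: cvgB; apply: step_cvg => // e e0.
  move/cvgrPdist_le : u0 => /(_ _ e0)/near_at_right[h1 h10 H1].
  apply: (@at_right_near _ _ _ (Num.min (T / 2) (h1 / 2))).
    by rewrite lt_min !divr_gt0.
  move=> h h0; rewrite add0r lt_min => /andP[h2 h3]; split.
    by move=> y /=; rewrite !in_itv/=; lra.
  move=> y; rewrite in_itv/= => /andP[y1 y2]; rewrite distrC -[y]add0r.
  by apply: H1; lra.
move/cvgrPdist_le : uT => /(_ _ e0)[h1 /= h10 H1].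
apply: (@at_right_near _ _ _ (Num.min (T / 4) (h1 / 4))).
  by rewrite lt_min !divr_gt0.
move=> h h0; rewrite add0r lt_min => /andP[h2 h3]; split.
  by move=> y /=; rewrite !in_itv/=; lra.
move=> y; rewrite in_itv/= => /andP[y1 y2]; rewrite distrC.
apply: H1 => /=; last by lra.
by rewrite gtr0_norm; lra.
Qed.

End cutoff.

(** * Consequences of the weak formulation *)

Section bounded_support.
Context {R : realType}.
Implicit Types f : R -> R.

Lemma derive1_out f (s t x : R) : (forall u, u \notin `[s, t] -> f u = 0) ->
  x \notin `[s, t] -> derive1 f x = 0.
Proof.
move=> f0; rewrite in_itv/= negb_and -!ltNge derive1E => /orP[xs|tx].
- rewrite (@near_eq_derive _ _ _ _ (cst (0:R))) ?derive_cst ?oner_neq0//.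
  near=> y; rewrite f0// in_itv/= negb_and -!ltNge; apply/orP; left.
  by near: y; exact: lt_nbhsl.
- rewrite (@near_eq_derive _ _ _ _ (cst (0:R))) ?derive_cst ?oner_neq0//.
  near=> y; rewrite f0// in_itv/= negb_and -!ltNge; apply/orP; right.
  by near: y; exact: lt_nbhsr.
Unshelve. all: end_near. Qed.

Lemma bounded_of_support f (s t : R) : continuous f ->
  (forall u, u \notin `[s, t] -> f u = 0) -> exists M, forall x, `|f x| <= M.
Proof.
move=> cf f0; have [st|ts] := leP s t; last first.
  exists 0 => x; rewrite f0 ?normr0// in_itv/=; apply/negP => /andP[sx xt].
  by move: ts; rewrite ltNge (le_trans sx).
have [|c _ hc] := @EVT_max R (fun x => `|f x|) s t st.
  apply: continuous_subspaceT => x; apply: continuous_comp; first exact: cf.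
  exact: norm_continuous.
exists `|f c| => x; have [xst|xst] := boolP (x \in `[s, t]); first exact: hc.
by rewrite f0 ?normr0.
Qed.

Lemma finite_integral_integrable d (X : measurableType d)
    (nu : {measure set X -> \bar R}) (D : set X) (f : X -> R) :
  measurable D -> measurable_fun D f ->
  (\int[nu]_(x in D) (f x)%:E \is a fin_num)%E ->
  nu.-integrable D (EFin \o f).
Proof.
move=> mD mf; have mf' : measurable_fun D (EFin \o f) by exact/measurable_EFinP.
rewrite integralE => fin; apply/integrableP; split => //.
under eq_integral do rewrite -/((abse \o (EFin \o f)) _) fune_abse.
rewrite ge0_integralD//; [|exact: measurable_funepos|exact: measurable_funeneg].
move: fin; rewrite -[(fun x => (f x)%:E)]/(EFin \o f).
have : (0 <= \int[nu]_(x in D) (EFin \o f)^\+ x)%E by exact: integral_ge0.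
have : (0 <= \int[nu]_(x in D) (EFin \o f)^\- x)%E by exact: integral_ge0.
case: (integral nu D _^\-)%E => [u||]; case: (integral nu D _^\+)%E => [v||] //= *.
by rewrite -EFinD ltry.
Qed.

End bounded_support.

Section weak_flux.
Context {R : realType}.
Local Notation mu := (@lebesgue_measure R).
Variables (T : R) (n : R -> R -> R).
Hypothesis T0 : 0 < T.
Hypothesis n_int : (mu \x mu)%E.-integrable (`[0, T] `*` `[0, +oo[)
  (fun p => (n p.1 p.2)%:E).
Hypothesis n_weak : weak_solution T n.

Local Notation D := (`[0, T]%classic `*` `[0, +oo[%classic).
Let F p := flux p.2 (n p.1 p.2).

Let mD : measurable (D : set (measurableTypeR R * measurableTypeR R)).
Proof. by apply: measurableX; exact: measurable_itv. Qed.

Let mn : measurable_fun (D : set (measurableTypeR R * measurableTypeR R))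
  (fun p => n p.1 p.2).
Proof. by apply/measurable_EFinP; exact: measurable_int n_int. Qed.

Let mc f (A : set (measurableTypeR R * measurableTypeR R)) : continuous f ->
  measurable_fun A (fun p : measurableTypeR R * measurableTypeR R => f p.1 : R) /\
  measurable_fun A (fun p : measurableTypeR R * measurableTypeR R => f p.2 : R).
Proof.
move=> cf; have mf : measurable_fun setT f by exact: continuous_measurable.
by split; apply: measurable_funTS; apply: measurableT_comp mf _;
  [exact: measurable_fst|exact: measurable_snd].
Qed.

Let mF : measurable_fun (D : set (measurableTypeR R * measurableTypeR R)) F.
Proof.
rewrite /F /flux; apply: measurable_funB; last exact: measurable_funX.
apply: measurable_funM => //.
apply: (mc (f := fun x => 2 * x - x ^+ 2) _ _).2 => x.
apply: cvgB; first by apply: cvgM; [exact: cvg_cst|exact: cvg_id].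
exact: exprn_continuous.
Qed.

Lemma weak_prod a b (s t c d : R) : smooth a -> smooth b ->
  0 < s -> t < T -> (forall u, u \notin `[s, t] -> a u = 0) ->
  0 < c -> (forall x, x \notin `[c, d] -> b x = 0) ->
  [/\ (mu \x mu)%E.-integrable D
        (EFin \o (fun p => b p.2 * (derive1 a p.1 * n p.1 p.2))),
      (mu \x mu)%E.-integrable D
        (EFin \o (fun p => derive1 b p.2 * (a p.1 * F p))) &
      Rintegral (mu \x mu)%E D (fun p => b p.2 * (derive1 a p.1 * n p.1 p.2)) +
      Rintegral (mu \x mu)%E D (fun p => derive1 b p.2 * (a p.1 * F p)) = 0].
Proof.
move=> sa sb s0 tT a0 c0 b0.
have ca := smooth_continuous sa; have cb := smooth_continuous sb.
have ca' := smooth_continuous (smooth_derive1 sa).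
have cb' := smooth_continuous (smooth_derive1 sb).
have [Ma hMa] := bounded_of_support ca' (fun u => @derive1_out _ _ s t u a0).
have [Mb hMb] := bounded_of_support cb b0.
have i1 : (mu \x mu)%E.-integrable D
    (EFin \o (fun p => b p.2 * (derive1 a p.1 * n p.1 p.2))).
  apply: (@integrable_weight2 _ _ _ _ _ mu mu _ _
    (fun p => derive1 a p.1 * n p.1 p.2) _ _ _ _ Mb) => //.
  - apply: (@integrable_weight1 _ _ _ _ _ mu mu _ _ (fun p => n p.1 p.2) _ _ _ _ Ma) => //.
    exact: continuous_measurable.
  - exact: continuous_measurable.
have := n_weak (test_function_prod sa sb s0 tT a0 c0 b0).
have E p : (n p.1 p.2 * dt (fun t x => a t * b x) p.1 p.2 +
   flux p.2 (n p.1 p.2) * dx (fun t x => a t * b x) p.1 p.2) =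
   (b p.2 * (derive1 a p.1 * n p.1 p.2)) + (derive1 b p.2 * (a p.1 * F p)).
  by rewrite dt_prod// dx_prod// /F; ring.
under eq_integral do rewrite E.
move=> I0.
(* A vanishing integral is finite, which yields the integrability of the flux. *)
have i12 : (mu \x mu)%E.-integrable D (EFin \o (fun p =>
   (b p.2 * (derive1 a p.1 * n p.1 p.2)) + (derive1 b p.2 * (a p.1 * F p)))).
  apply: finite_integral_integrable => //; last by rewrite I0.
  apply: measurable_funD; first by apply/measurable_EFinP; exact: measurable_int i1.
  apply: measurable_funM; first exact: (mc _ cb').2.
  by apply: measurable_funM => //; exact: (mc _ ca).1.
have i2 : (mu \x mu)%E.-integrable D
    (EFin \o (fun p => derive1 b p.2 * (a p.1 * F p))).
  have := integrable_subr mD i12 i1; congr integrable.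
  by apply/funext => p /=; rewrite addrAC subrr add0r.
split => //; rewrite -RintegralD//.
by rewrite /Rintegral I0.
Qed.

Section time_cutoff.
Variables (a : R -> R) (s t : R).
Hypotheses (sa : smooth a) (s0 : 0 < s) (tT : t < T).
Hypothesis a0 : forall u, u \notin `[s, t] -> a u = 0.

Definition cut_flux x := \int[mu]_(t in `[0, T]) (a t * flux x (n t x)).
Definition cut_source x := \int[mu]_(t in `[0, T]) (derive1 a t * n t x).

Lemma cut_source_integrable2 : (mu \x mu)%E.-integrable D
  (EFin \o (fun p => derive1 a p.1 * n p.1 p.2)).
Proof.
have ca' := smooth_continuous (smooth_derive1 sa).
have [M hM] := bounded_of_support ca' (fun u => @derive1_out _ _ s t u a0).
apply: (@integrable_weight1 _ _ _ _ _ mu mu _ _ (fun p => n p.1 p.2) _ _ _ _ M) => //.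
exact: continuous_measurable.
Qed.

Lemma cut_flux_integrable2 c d : 0 < c -> c <= d ->
  (mu \x mu)%E.-integrable (`[0, T] `*` `[c, d])
  (EFin \o (fun p => a p.1 * F p)).
Proof.
move=> c0 cd; set h := c / 4.
have h0 : 0 < h by rewrite divr_gt0.
(* [b] is the identity near [c, d]: there the weak formulation sees the bare
   flux. *)
pose b z := z * cut h (d + 1) h z.
have sb : smooth b by apply: smoothM; [exact: smooth_id|exact: smooth_cut].
have b0 x : x \notin `[h, d + 1 + h] -> b x = 0.
  by move=> xh; rewrite /b cut_out ?mulr0//; rewrite /h; lra.
have b1 x : x \in `[c, d] -> derive1 b x = 1.
  rewrite in_itv/= => /andP[cx xd]; rewrite derive1E.
  rewrite (@near_eq_derive _ _ _ _ id) ?derive_id ?oner_neq0//.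
  near=> y; rewrite /b cut_in ?mulr1//; apply/andP; split.
    rewrite ltW//; near: y; apply: lt_nbhsr; rewrite /h; lra.
  by rewrite ltW//; near: y; apply: lt_nbhsl; lra.
have [_ i2 _] := weak_prod sa sb s0 tT a0 h0 b0.
have mB : measurable (`[0, T] `*` `[c, d] : set (measurableTypeR R * measurableTypeR R)).
  by apply: measurableX; exact: measurable_itv.
apply: (@eq_integrable _ _ _ _ _ mB (EFin \o (fun p => derive1 b p.2 * (a p.1 * F p)))).
  by move=> p /set_mem[_ /=] /b1 ->; rewrite mul1r.
apply: integrableS i2 => // p [/= ? h2]; split => //=.
by move: h2; rewrite /= !in_itv/= andbT => /andP[/(le_trans _)-> //]; exact: ltW.
Unshelve. all: end_near. Qed.

Lemma cut_flux_integrable c d : 0 < c -> c <= d ->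
  mu.-integrable `[c, d] (EFin \o cut_flux).
Proof.
move=> c0 cd.
exact: (@fubini_integrable2 _ _ _ _ _ mu mu _ _ _ _ _ (cut_flux_integrable2 c0 cd)).
Qed.

Lemma cut_source_integrable : mu.-integrable `[0, +oo[ (EFin \o cut_source).
Proof.
exact: (@fubini_integrable2 _ _ _ _ _ mu mu _ _ _ _ _ cut_source_integrable2).
Qed.

Lemma cut_flux_diff c d x y : 0 < c -> c < x -> x < y -> y < d ->
  lebesgue_pt (cut_flux \_ `[c, d]) x -> lebesgue_pt (cut_flux \_ `[c, d]) y ->
  cut_flux y - cut_flux x = \int[mu]_(z in `]x, y]) cut_source z.
Proof.
move=> c0 cx xy yd px py.
have cd : c <= d by rewrite (le_trans (ltW cx))// (le_trans (ltW xy))// ltW.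
pose e := Num.min (y - x) (d - y).
have e0 : 0 < e by rewrite lt_min !subr_gt0 xy.
pose h k := e / k.+1%:R.
have h0 k : 0 < h k by rewrite divr_gt0.
have he k : h k <= e by rewrite ler_pdivrMr// ler_peMr ?(ltW e0)// ler1n.
have xh k : x + h k <= y by rewrite -lerBrDl (le_trans (he k))// ge_min lexx.
have yh k : y + h k <= d by rewrite -lerBrDl (le_trans (he k))// ge_min lexx orbT.
have b0 k z : z \notin `[x, y + h k] -> cut x y (h k) z = 0 by exact: cut_out.
have x0 : 0 < x by exact: lt_trans cx.
have iS := cut_source_integrable; have iF := cut_flux_integrable c0 cd.
have key k : \int[mu]_(z in `[0, +oo[) (cut x y (h k) z * cut_source z) +
    \int[mu]_(z in `[c, d]) (derive1 (cut x y (h k)) z * cut_flux z) = 0.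
  have sb : smooth (cut x y (h k)) by exact: smooth_cut.
  have [_ _ w0] := weak_prod sa sb s0 tT a0 x0 (b0 k); rewrite -[RHS]w0.
  have cb := smooth_continuous sb; have cb' := smooth_continuous (smooth_derive1 sb).
  have [M hM] := bounded_of_support cb (b0 k).
  have b0' u : u \notin `[x, y + h k] -> derive1 (cut x y (h k)) u = 0.
    by move=> uk; apply: derive1_out uk; exact: b0.
  have [M' hM'] := bounded_of_support cb' b0'.
  congr (_ + _).
    apply/esym.
    rewrite (@fubini_weight2 _ _ _ _ _ mu mu _ _ (fun p => derive1 a p.1 * n p.1 p.2)
      _ _ cut_source_integrable2 (cut x y (h k)) M) => //; try exact: measurable_itv.
    exact: continuous_measurable.
  apply/esym.
  rewrite (@Rintegral_subset _ _ _ (mu \x mu)%E _ (`[0, T] `*` `[c, d])).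
  - rewrite (@fubini_weight2 _ _ _ _ _ mu mu _ _ (fun p => a p.1 * F p)
      _ _ (cut_flux_integrable2 c0 cd) (derive1 (cut x y (h k))) M') => //;
      try exact: measurable_itv.
    exact: continuous_measurable.
  - move=> p [/= ? h2]; split => //=.
    by move: h2; rewrite /= !in_itv/= andbT => /andP[/(le_trans _)-> //]; exact: ltW.
  - move=> p [/= p1 p2] np; rewrite b0' ?mul0r//; apply/negP => pxy; apply: np.
    split => //=; move: pxy; rewrite !in_itv/= => /andP[xp py'].
    by rewrite (le_trans (ltW cx))//= (le_trans py').
have lim1 : \int[mu]_(z in `[0, +oo[) (cut x y (h k) z * cut_source z)
    @[k --> \oo] --> \int[mu]_(z in `]x, y]) cut_source z.
  have -> : \int[mu]_(z in `]x, y]) cut_source z =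
      \int[mu]_(z in `[0, +oo[) (cut_source \_ `]x, y]) z.
    rewrite -Rintegral_mkcondr; congr Rintegral; apply/esym/setIidPr => z /=.
    by rewrite !in_itv/= andbT => /andP[/ltW xz _]; rewrite (le_trans _ xz)// ltW.
  have [|||||_ h'] := @Rintegral_dominated _ _ _ mu `[0%R, +oo[%classic
    (fun k z => cut x y (h k) z * cut_source z) (cut_source \_ `]x, y])
    (fun z => `|cut_source z|).
  - exact: measurable_itv.
  - move=> k; apply: measurable_funM.
      by apply: continuous_measurable => //; exact/smooth_continuous/smooth_cut.
    by apply/measurable_EFinP; exact: measurable_int iS.
  - move=> z _; rewrite patchE; have [zxy|zxy] := boolP (z \in (`]x, y]%classic)).
      rewrite -[X in _ --> X]mul1r; apply: cvgM; last exact: cvg_cst.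
      apply: (@cvg_at_right_seq _ e (fun h => cut x y h z)) => //; apply: cvg_cut.
      by move: zxy => /set_mem; rewrite /= in_itv.
    rewrite -[X in _ --> X](mul0r (cut_source z)); apply: cvgM; last exact: cvg_cst.
    apply: (@cvg_at_right_seq _ e (fun h => cut x y h z)) => //; apply: cvg_cut_out => //.
    move: zxy; rewrite notin_setE /= in_itv/= => /negP; rewrite negb_and -ltNge -leNgt.
    by move=> /orP.
  - exact: integrable_norm.
  - move=> k z _; rewrite normrM ler_piMl//.
    by have /andP[c1 c2] := cut_itv01 z (h0 k) (xh k); rewrite ger0_norm.
  exact: h'.
have lim2 : \int[mu]_(z in `[c, d]) (derive1 (cut x y (h k)) z * cut_flux z)
    @[k --> \oo] --> cut_flux x - cut_flux y.
  have bS p k : mu.-integrable `[c, d]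
      (EFin \o (fun t => derive1 (step_at p (h k)) t * cut_flux t)).
    have [C _ hC] := @derive1_step_bounded R.
    apply: (@integrable_bounded_mul _ _ _ _ _ _ _ (C / h k)) => //.
      exact: measurable_derive1_step_at.
    move=> z _; rewrite derive1_step_at normrM.
    by rewrite [`|(h k)^-1|]gtr0_norm ?invr_gt0// ler_pM2r ?invr_gt0.
  have -> : (fun k => \int[mu]_(z in `[c, d]) (derive1 (cut x y (h k)) z * cut_flux z)) =
    (fun k => \int[mu]_(z in `[c, d]) (derive1 (step_at x (h k)) z * cut_flux z) -
     \int[mu]_(z in `[c, d]) (derive1 (step_at y (h k)) z * cut_flux z)).
    apply/funext => k; rewrite -RintegralB//.
    by apply: eq_Rintegral => z _; rewrite derive1_cut mulrBl.
  apply: cvgB.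
    apply: (@cvg_at_right_seq _ e (fun h => \int[mu]_(z in `[c, d])
      (derive1 (step_at x h) z * cut_flux z)) _ e0).
    by apply: (step_lebesgue_pt iF _ px); rewrite cx (lt_trans xy).
  apply: (@cvg_at_right_seq _ e (fun h => \int[mu]_(z in `[c, d])
      (derive1 (step_at y h) z * cut_flux z)) _ e0).
  by apply: (step_lebesgue_pt iF _ py); rewrite yd (lt_trans cx).
have lim0 := cvgD lim1 lim2.
rewrite [X in X @ _ --> _](_ : _ = cst 0) in lim0; last exact/funext/key.
have e1 : 0 = \int[mu]_(z in `]x, y]) cut_source z + (cut_flux x - cut_flux y).
  exact: (norm_cvg_unique (cvg_cst 0) (lim0 _)).
by move/esym/eqP : e1; rewrite addr_eq0 opprB => /eqP ->.
Qed.

End time_cutoff.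
End weak_flux.

(** * Traces of the flux *)

#[local] Instance ae_lebesgue_filter (R : realType) :
  Filter (nbhs (almost_everywhere (@lebesgue_measure R))).
Proof. exact: ae_filter_ringOfSetsType. Qed.

Section traces.
Context {R : realType}.
Local Notation mu := (@lebesgue_measure R).
Implicit Types (T r x : R) (n : R -> R -> R) (g : R -> R).

Lemma continuous_quad : continuous (fun x : R => 2 * x - x ^+ 2).
Proof.
move=> x; apply: cvgB; first by apply: cvgM; [exact: cvg_cst|exact: cvg_id].
exact: exprn_continuous.
Qed.

Lemma measurable_flux (D : set R) x (u : R -> R) : measurable D ->
  measurable_fun D u -> measurable_fun D (fun t => flux x (u t)).
Proof.
move=> mD mu_; rewrite /flux; apply: measurable_funB; last exact: measurable_funX.
exact: measurable_funM.
Qed.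

Lemma integrable_cst_lty (D : set R) (c : R) : measurable D -> (mu D < +oo)%E ->
  mu.-integrable D (EFin \o cst c).
Proof.
move=> mD Dfin; apply: measurable_bounded_integrable => //.
by exists `|c|; split; [exact: num_real|move=> M cM t _; exact: ltW].
Qed.

Lemma integrable_sqr_of_flux (D : set R) r g : measurable D -> (mu D < +oo)%E ->
  measurable_fun D g -> mu.-integrable D (fun t => (flux r (g t))%:E) ->
  mu.-integrable D (fun t => (g t ^+ 2)%:E).
Proof.
move=> mD Dfin mg iF; pose c := 2 * r - r ^+ 2.
have ib : mu.-integrable D (EFin \o (fun t => c ^+ 2 + 2 * `|flux r (g t)|)).
  apply: (@integrable_addr _ _ _ mu D (cst (c ^+ 2))) => //.
    exact: integrable_cst_lty.
  by apply: integrable_mulr => //; exact: (integrable_norm iF).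
apply: le_integrable ib => //; first exact/measurable_EFinP/measurable_funX.
move=> t _; rewrite !lee_fin ger0_norm ?sqr_ge0// ger0_norm ?addr_ge0 ?sqr_ge0//.
have := ler_norm (- flux r (g t)); rewrite normrN.
have := sqr_ge0 (g t - c); rewrite /flux -/c; nra.
Qed.

Lemma integrable_sqr_of_close (D : set R) (u g : R -> R) : measurable D ->
  measurable_fun D g -> mu.-integrable D (fun t => (u t ^+ 2)%:E) ->
  mu.-integrable D (fun t => ((u t - g t) ^+ 2)%:E) ->
  mu.-integrable D (fun t => (g t ^+ 2)%:E).
Proof.
move=> mD mg iu iug.
have ib : mu.-integrable D (EFin \o (fun t => 2 * u t ^+ 2 + 2 * (u t - g t) ^+ 2)).
  by apply: integrable_addr => //; apply: integrable_mulr.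
apply: le_integrable ib => //; first exact/measurable_EFinP/measurable_funX.
move=> t _; rewrite !lee_fin ger0_norm ?sqr_ge0// ger0_norm.
  by have := sqr_ge0 (2 * u t - g t); nra.
by rewrite addr_ge0// mulr_ge0// sqr_ge0.
Qed.

Lemma integrable_of_sqr (D : set R) (g : R -> R) : measurable D -> (mu D < +oo)%E ->
  measurable_fun D g -> mu.-integrable D (fun t => (g t ^+ 2)%:E) ->
  mu.-integrable D (EFin \o g).
Proof.
move=> mD Dfin mg ig.
have ib : mu.-integrable D (EFin \o (fun t => 1 + g t ^+ 2)).
  apply: (@integrable_addr _ _ _ mu D (cst 1)) => //.
  exact: integrable_cst_lty.
apply: le_integrable ib => //; first exact/measurable_EFinP.
move=> t _; rewrite !lee_fin [leRHS]ger0_norm ?addr_ge0 ?sqr_ge0//.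
by have := sqr_ge0 (`|g t| - 1); rewrite -[g t ^+ 2]real_normK ?num_real//; nra.
Qed.

Lemma flux_dist_le (x r y z e C : R) : 0 < e -> `|2 * x - x ^+ 2| <= C ->
  `|(2 * x - x ^+ 2) - (2 * r - r ^+ 2)| <= e ->
  `|flux x y - flux r z| <= 2 * e * (1 + z ^+ 2) +
     ((C ^+ 2 + 1) / e + 1) * (y - z) ^+ 2.
Proof.
move=> e0 xC xr; set d := y - z.
set k := (2 * x - x ^+ 2) - (2 * r - r ^+ 2) in xr *.
set c := 2 * x - x ^+ 2 in xC k xr *.
have -> : flux x y - flux r z = k * z + c * d - 2 * z * d - d ^+ 2.
  by rewrite /flux /d /k /c; ring.
have C0 : 0 <= C by rewrite (le_trans _ xC).
have h1 : `|k * z| <= e * (1 + z ^+ 2).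
  rewrite normrM ler_pM//.
  by have := sqr_ge0 (`|z| - 1); rewrite -[z ^+ 2]real_normK ?num_real//; nra.
have h2 : `|c * d| <= e + C ^+ 2 / e * d ^+ 2.
  rewrite normrM (@le_trans _ _ (C * `|d|))// ?ler_wpM2r//.
  have -> : C ^+ 2 / e * d ^+ 2 = (C * `|d|) ^+ 2 / e.
    by rewrite exprMn real_normK ?num_real//; ring.
  set w := C * `|d|.
  have : 0 <= (w - e) ^+ 2 / e by rewrite divr_ge0 ?sqr_ge0// ltW.
  have w0 : 0 <= w by rewrite mulr_ge0.
  have -> : (w - e) ^+ 2 / e = w ^+ 2 / e - 2 * w + e by field; rewrite gt_eqF.
  by lra.
have h3 : `|2 * z * d| <= e * z ^+ 2 + e^-1 * d ^+ 2.
  have : 0 <= (e * `|z| - `|d|) ^+ 2 / e by rewrite divr_ge0 ?sqr_ge0// ltW.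
  have -> : (e * `|z| - `|d|) ^+ 2 / e =
      e * `|z| ^+ 2 + e^-1 * `|d| ^+ 2 - `|2 * z * d|.
    by rewrite !normrM normr_nat; field; rewrite gt_eqF.
  by rewrite !real_normK ?num_real//; lra.
have h4 : `|d ^+ 2| <= d ^+ 2 by rewrite ger0_norm ?sqr_ge0.
apply: (@le_trans _ _ (`|k * z| + `|c * d| + `|2 * z * d| + `|d ^+ 2|)).
  by rewrite (le_trans (ler_normB _ _))// lerD2r (le_trans (ler_normB _ _))// lerD2r ler_normD.
have -> : (C ^+ 2 + 1) / e = C ^+ 2 / e + e^-1 by rewrite mulrDl mul1r.
by nra.
Qed.

Lemma trace_flux T n r (G : set_system R) g : 0 < T -> Filter G ->
  G `=>` nbhs r -> (\forall x \near G, measurable_fun `[0, T] (n^~ x)) ->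
  trace T n G g -> mu.-integrable `[0, T] (fun t => (g t ^+ 2)%:E) ->
  forall e, 0 < e -> exists2 A : set R, G A & {ae mu, forall x, A x ->
    [/\ mu.-integrable `[0, T] (fun t => ((n t x - g t) ^+ 2)%:E),
        mu.-integrable `[0, T] (fun t => (flux x (n t x))%:E) &
        \int[mu]_(t in `[0, T]) `|flux x (n t x) - flux r (g t)| <= e]}.
Proof.
move=> T0 FG Gr mG [mg tr] ig2 e e0.
have mI : measurable (`[0, T]%classic : set (measurableTypeR R)) by exact: measurable_itv.
have muI : mu `[0, T]%classic = T%:E.
  by rewrite lebesgue_measure_itv/= lte_fin T0 oppr0 adde0.
have Ifin : (mu `[0%R, T]%classic < +oo)%E by rewrite muI ltry.
pose S := T + \int[mu]_(t in `[0, T]) g t ^+ 2.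
have S0 : 0 < S.
  by rewrite ltr_pwDl//; apply: Rintegral_ge0 => t _; exact: sqr_ge0.
pose h := e / (4 * S); have h0 : 0 < h by rewrite divr_gt0// mulr_gt0.
pose C := `|2 * r - r ^+ 2| + 1.
pose K := (C ^+ 2 + 1) / h + 1.
have K0 : 0 < K.
  by rewrite ltr_wpDl// divr_ge0 ?(ltW h0)// addr_ge0// sqr_ge0.
have [A0 GA0 aeA0] := tr (e / (2 * K)) (divr_gt0 e0 (mulr_gt0 (ltr0Sn _ 1) K0)).
pose A1 := [set x | `|(2 * x - x ^+ 2) - (2 * r - r ^+ 2)| <= Num.min h 1].
have GA1 : G A1.
  apply: Gr; have m0 : 0 < Num.min h 1 :> R by rewrite lt_min h0 ltr01.
  have : (2 * x - x ^+ 2) @[x --> r] --> 2 * r - r ^+ 2 by exact: continuous_quad.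
  move/cvgrPdist_le => /(_ _ m0).
  by apply: filterS => x; rewrite /A1/= distrC.
exists (A0 `&` A1 `&` [set x | measurable_fun `[0, T] (n^~ x)]).
  by apply: filterI => //; exact: filterI.
move: aeA0; apply: filterS => x aex [[A0x A1x] mx].
have {}aex := aex A0x.
have mng : measurable_fun `[0, T] (fun t => (n t x - g t) ^+ 2).
  by apply: measurable_funX; exact: measurable_funB.
have id2 : mu.-integrable `[0, T] (EFin \o (fun t => (n t x - g t) ^+ 2)).
  apply/integrableP; split; first exact/measurable_EFinP.
  under eq_integral do rewrite /= ger0_norm ?sqr_ge0//.
  exact: lt_trans aex (ltry _).
have ig := integrable_of_sqr mI Ifin mg ig2.
have iFg : mu.-integrable `[0, T] (EFin \o (fun t => flux r (g t))).
  apply: integrable_subr => //; exact: integrable_mulr.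
have ib : mu.-integrable `[0, T] (EFin \o (fun t => 2 * h * (1 + g t ^+ 2))).
  apply: integrable_mulr => //.
  apply: (@integrable_addr _ _ _ mu _ (cst 1)) => //; exact: integrable_cst_lty.
have iK : mu.-integrable `[0, T] (EFin \o (fun t => K * (n t x - g t) ^+ 2)).
  exact: integrable_mulr.
have ibK := integrable_addr mI ib iK.
have dF t : `|flux x (n t x) - flux r (g t)| <=
    2 * h * (1 + g t ^+ 2) + K * (n t x - g t) ^+ 2.
  move: A1x; rewrite /A1/= le_min => /andP[xh x1].
  apply: flux_dist_le => //; rewrite /C.
  set c := 2 * r - r ^+ 2 in x1 *; set c' := 2 * x - x ^+ 2 in x1 *.
  by rewrite -[c'](subrK c) addrC (le_trans (ler_normD _ _))// lerD2l.
have idF : mu.-integrable `[0, T] (EFin \o (fun t => flux x (n t x) - flux r (g t))).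
  apply: le_integrable ibK => //.
    apply/measurable_EFinP; apply: measurable_funB; first exact: measurable_flux.
    exact: measurable_flux.
  move=> t _; rewrite !lee_fin (le_trans (dF t))//; exact: ler_norm.
split => //.
- have := integrable_addr mI idF iFg; congr integrable.
  by apply/funext => t /=; rewrite subrK.
- apply: (le_trans (le_Rintegral mI (integrable_norm idF) ibK (fun t _ => dF t))).
  rewrite RintegralD// !RintegralZl//; last first.
    apply: (@integrable_addr _ _ _ mu _ (cst 1)) => //; exact: integrable_cst_lty.
  rewrite RintegralD//; last exact: integrable_cst_lty.
  rewrite Rintegral_cst//= lebesgue_measure_itv/= lte_fin T0 oppr0 adde0/= mul1r -/S.
  have -> : 2 * h * S = e / 2 by rewrite /h; field; rewrite gt_eqF.
  rewrite [leRHS](splitr e) lerD2l -ler_pdivlMl//.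
  rewrite (_ : K^-1 * (e / 2) = e / (2 * K)); last by field; rewrite gt_eqF.
  by rewrite -lee_fin fineK ?integrable_fin_num// ltW.
Qed.

End traces.

(** * The flux identity *)

Section flux_identity.
Context {R : realType}.
Local Notation mu := (@lebesgue_measure R).
Implicit Types (x y : R).

Definition tail (u : R -> R) x : R := \int[mu]_(z in `]x, +oo[) u z.

Lemma ae_exists_itv (a b : R) (P : R -> Prop) : a < b ->
  {ae mu, forall x, P x} -> exists x, [/\ a < x, x < b & P x].
Proof.
move=> ab [N [mN N0 PN]]; apply/not_existsP => noP.
have : (mu `]a, b[%classic <= mu N)%E.
  apply: le_measure; rewrite ?inE//.
  move=> x /=; rewrite in_itv/= => /andP[ax xb]; apply: PN => Px.
  by apply: (noP x); split.
by rewrite N0 lebesgue_measure_itv/= lte_fin ab leNgt -EFinD lte_fin subr_gt0 ab.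
Qed.

Lemma cvge0_near_lt (F : set_system R) (f : R -> \bar R) (e : R) :
  Filter F -> 0 < e -> (forall x, 0 <= f x)%E ->
  f x @[x --> F] --> 0%E -> \forall x \near F, (f x < e%:E)%E.
Proof.
move=> FF e0 f0 /fine_cvgP[fin /cvgrPdist_lt/(_ _ e0)]; move: fin.
apply: filterS2 => x fx; rewrite /= sub0r normrN => /(le_lt_trans (ler_norm _)).
by rewrite -lte_fin fineK.
Qed.

Variables (T : R) (n : R -> R -> R).
Hypothesis T0 : 0 < T.
Hypothesis n_int : (mu \x mu)%E.-integrable (`[0, T] `*` `[0, +oo[)
  (fun p => (n p.1 p.2)%:E).
Hypothesis n_weak : weak_solution T n.
Hypothesis n_oo : flux_vanishes_at_infinity T n.
Hypothesis n_L1 : forall t, 0 <= t -> mu.-integrable `[0, +oo[ (EFin \o n t).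
Hypothesis n_cont : forall t, 0 <= t ->
  (\int[mu]_(x in `[0%R, +oo[) (`|n s x - n t x|)%:E)%E
    @[s --> within [set s | 0 <= s] (nbhs t)] --> 0%E.

Lemma measurable_section x : 0 <= x -> measurable_fun `[0, T] (n^~ x).
Proof.
move=> x0; have mn : measurable_fun
    (`[0, T] `*` `[0, +oo[ : set (measurableTypeR R * measurableTypeR R))
    (fun p => n p.1 p.2).
  by apply/measurable_EFinP; exact: measurable_int n_int.
apply: (@measurable_comp _ _ _ _ _ _ (`[0, T] `*` `[0, +oo[
  : set (measurableTypeR R * measurableTypeR R)) (fun p => n p.1 p.2) `[0, T]%classic
  (fun t : measurableTypeR R => (t, x : measurableTypeR R))) => //.
- by apply: measurableX; exact: measurable_itv.
- by move=> _ [t tT <-]; split => //=; rewrite in_itv/= x0.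
- exact: measurable_funTS (pair2_measurable _).
Qed.

Lemma far_small_flux (P : R -> Prop) (b e : R) : {ae mu, forall x, P x} -> 0 < e ->
  exists y, [/\ b < y, P y, mu.-integrable `[0, T] (fun t => (flux y (n t y))%:E) &
    \int[mu]_(t in `[0, T]) `|flux y (n t y)| <= e].
Proof.
move=> aeP e0; have [g [tg g0]] := n_oo.
have mI : measurable (`[0, T]%classic : set (measurableTypeR R)) by exact: measurable_itv.
have Ifin : (mu `[0%R, T]%classic < +oo)%E.
  by rewrite lebesgue_measure_itv/= lte_fin T0 oppr0 adde0 ltry.
have e20 : 0 < e / 2 by rewrite divr_gt0.
have [r [[tr fr] br]] : exists r, (trace T n r^'- (g r) /\
    (\int[mu]_(t in `[0%R, T]) (`|flux r (g r t)|)%:E < (e / 2)%:E)%E) /\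
    Num.max b 0 < r.
  have g0' : \forall r \near +oo,
      (\int[mu]_(t in `[0%R, T]) (`|flux r (g r t)|)%:E < (e / 2)%:E)%E.
    by apply: (cvge0_near_lt _ e20 _ g0) => r; apply: integral_ge0 => t _; rewrite lee_fin.
  apply: (@filter_ex _ (pinfty_nbhs R)).
  apply: filterI; first exact: filterI.
  by apply: nbhs_pinfty_gt; exact: num_real.
move: br; rewrite gt_max => /andP[br r0].
have mg := tr.1.
have iF : mu.-integrable `[0, T] (fun t => (flux r (g r t))%:E).
  apply/integrableP; split; first by apply/measurable_EFinP; exact: measurable_flux.
  by under eq_integral do rewrite abse_EFin; exact: lt_trans fr (ltry _).
have ig2 := integrable_sqr_of_flux mI Ifin mg iF.
have Gr : r^'- `=>` nbhs r by exact: cvg_within.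
have mG : \forall x \near r^'-, measurable_fun `[0, T] (n^~ x).
  by near=> x; apply: measurable_section; near: x; exact: nbhs_left_ge.
have [A [h /= h0 hA] aeA] := trace_flux T0 _ Gr mG tr ig2 e20.
have [y [y1 y2 [Py By]]] : exists y, [/\ Num.max (r - h) (Num.max b 0) < y, y < r &
    P y /\ (A y -> [/\ mu.-integrable `[0, T] (fun t => ((n t y - g r t) ^+ 2)%:E),
        mu.-integrable `[0, T] (fun t => (flux y (n t y))%:E) &
        \int[mu]_(t in `[0, T]) `|flux y (n t y) - flux r (g r t)| <= e / 2])].
  apply: ae_exists_itv; last exact: filterI.
  by rewrite !gt_max br r0 ltrBlDr ltrDl h0.
move: y1; rewrite !gt_max => /and3P[hy by0 y0].
have [_ iFy dF] : [/\ mu.-integrable `[0, T] (fun t => ((n t y - g r t) ^+ 2)%:E),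
        mu.-integrable `[0, T] (fun t => (flux y (n t y))%:E) &
        \int[mu]_(t in `[0, T]) `|flux y (n t y) - flux r (g r t)| <= e / 2].
  by apply: By; apply: hA => //=; rewrite gtr0_norm ?subr_gt0// ltrBlDr -ltrBlDl.
exists y; split => //.
have idF := integrable_subr mI iFy iF.
apply: (@le_trans _ _ (\int[mu]_(t in `[0, T])
    (`|flux y (n t y) - flux r (g r t)| + `|flux r (g r t)|))).
  apply: le_Rintegral => //.
  - exact: (integrable_norm iFy).
  - by apply: integrable_addr => //; [exact: (integrable_norm idF)|exact: (integrable_norm iF)].
  - by move=> t _; rewrite (le_trans _ (ler_normD _ _))// subrK.
rewrite RintegralD//; [|exact: (integrable_norm idF)|exact: (integrable_norm iF)].
rewrite (splitr e) lerD// ltW// -lte_fin fineK//.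
by apply: integrable_fin_num => //; exact: (integrable_norm iF).
Unshelve. all: end_near. Qed.

Definition regular (a : R -> R) x := forall j : nat,
  lebesgue_pt (cut_flux T n a \_ `[j.+1%:R^-1, j.+1%:R]) x.

Section time_cutoff.
Variables (a : R -> R) (s t : R).
Hypotheses (sa : smooth a) (s0 : 0 < s) (tT : t < T).
Hypothesis a0 : forall u, u \notin `[s, t] -> a u = 0.
Hypothesis a1 : forall u, `|a u| <= 1.

Lemma ae_regular : {ae mu, forall x, regular a x}.
Proof.
apply: ae_foralln => j; apply: lebesgue_differentiation.
apply: open_integrable_locally; first exact: openT.
have j0 : 0 < j.+1%:R^-1 :> R by rewrite invr_gt0.
have jj : j.+1%:R^-1 <= j.+1%:R :> R.
  by rewrite (@le_trans _ _ 1)// ?ler1n// invf_le1// ler1n.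
have mj : measurable (`[j.+1%:R^-1, j.+1%:R]%classic : set (measurableTypeR R)).
  exact: measurable_itv.
have := (integrable_mkcond _ mj).1 (cut_flux_integrable n_int n_weak sa s0 tT a0 j0 jj).
by rewrite restrict_EFin.
Qed.

Lemma regular_diff x y : 0 < x -> x < y -> regular a x -> regular a y ->
  cut_flux T n a y - cut_flux T n a x =
  \int[mu]_(z in `]x, y]) cut_source T n a z.
Proof.
move=> x0 xy rx ry.
pose j := maxn (Num.truncn (x^-1)) (Num.truncn y).
have yj : y < j.+1%:R.
  by rewrite (lt_le_trans (truncnS_gt y))// ler_nat ltnS leq_maxr.
have xj : j.+1%:R^-1 < x.
  rewrite -[x]invrK ltf_pV2 ?posrE ?invr_gt0//.
  by rewrite (lt_le_trans (truncnS_gt _))// ler_nat ltnS leq_maxl.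
have j0 : 0 < j.+1%:R^-1 :> R by rewrite invr_gt0.
exact: (cut_flux_diff n_int n_weak sa s0 tT a0 j0 xj xy yj (rx j) (ry j)).
Qed.

Lemma cut_flux_tail x : 0 < x -> regular a x ->
  cut_flux T n a x = - \int[mu]_(u in `[0, T]) (derive1 a u * tail (n u) x).
Proof.
move=> x0 rx.
have ey (k : nat) : exists y, [/\ x + k%:R < y, regular a y,
    mu.-integrable `[0, T] (fun t => (flux y (n t y))%:E) &
    \int[mu]_(t in `[0, T]) `|flux y (n t y)| <= k.+1%:R^-1].
  by apply: far_small_flux; [exact: ae_regular|rewrite invr_gt0].
have [y hy] := choice ey.
have xy k : x < y k.
  by have [xk _ _ _] := hy k; rewrite (le_lt_trans _ xk)// lerDl.
have yoo : y k @[k --> \oo] --> +oo.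
  apply/cvgryPge => M; near=> k; have [xk _ _ _] := hy k.
  rewrite (le_trans _ (ltW xk))// (@le_trans _ _ k%:R)//; last by rewrite lerDr ltW.
  by near: k; exact: nbhs_infty_ger.
have y0 : cut_flux T n a (y k) @[k --> \oo] --> 0.
  have h0 : k.+1%:R^-1 @[k --> \oo] --> (0 : R) by exact: cvg_harmonic.
  apply/norm_cvg0P; apply: (squeeze_cvgr _ (cvg_cst 0) h0).
  apply: nearW => k; rewrite normr_ge0/=; have [_ _ ik le_k] := hy k.
  apply: le_trans le_k; rewrite /cut_flux.
  have iak : mu.-integrable `[0, T] (EFin \o (fun t => a t * flux (y k) (n t (y k)))).
    apply: (@integrable_bounded_mul _ _ _ _ _ _ _ 1) => //.
    by apply: continuous_measurable => //; exact: smooth_continuous.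
  have mI : measurable (`[0, T]%classic : set (measurableTypeR R)) by exact: measurable_itv.
  apply: (le_trans (le_normr_Rintegral mI iak)).
  apply: le_Rintegral => //; [exact: integrable_norm iak|exact: (integrable_norm ik)|].
  by move=> u _; rewrite normrM ler_piMl.
have iS := cut_source_integrable n_int sa a0.
have xoo : `]x, +oo[ `<=` `[0, +oo[.
  by move=> z; rewrite /= !in_itv/= !andbT => /ltW; apply: le_trans; exact: ltW.
have iSx : mu.-integrable `]x, +oo[ (EFin \o cut_source T n a) by exact: integrableS iS.
have lim1 := cvg_Rintegral_tail iSx xy yoo.
have lim2 : cut_flux T n a (y k) - cut_flux T n a x @[k --> \oo] --> 0 - cut_flux T n a x.
  by apply: cvgB y0 _; exact: cvg_cst.
have E : (fun k => cut_flux T n a (y k) - cut_flux T n a x) =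
    (fun k => \int[mu]_(z in `]x, y k]) cut_source T n a z).
  by apply/funext => k; have [_ ry _ _] := hy k; exact: (regular_diff x0 (xy k) rx ry).
rewrite E sub0r in lim2; have e1 := norm_cvg_unique lim2 lim1 : - cut_flux T n a x = _.
rewrite -[LHS]opprK e1; congr (- _).
pose f p := derive1 a p.1 * n p.1 p.2.
have mI : measurable (`[0, T]%classic : set (measurableTypeR R)) by exact: measurable_itv.
have mx : measurable (`]x, +oo[%classic : set (measurableTypeR R)) by exact: measurable_itv.
have if_ : (mu \x mu)%E.-integrable (`[0, T] `*` `]x, +oo[) (EFin \o f).
  apply: integrableS (cut_source_integrable2 n_int sa a0).
  - by apply: measurableX; exact: measurable_itv.
  - exact: measurableX.
  - by move=> p [p1 p2]; split => //; exact: xoo.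
transitivity (\int[mu]_(z in `]x, +oo[) \int[mu]_(t in `[0, T]) f (t, z)).
  by [].
rewrite -(@fubini_Rintegral2 _ _ _ _ _ mu mu _ _ _ mI mx if_).
rewrite (@fubini_Rintegral1 _ _ _ _ _ mu mu _ _ _ mI mx if_).
apply: eq_Rintegral => u /set_mem; rewrite /= in_itv/= => /andP[u0 _].
by rewrite /f/= RintegralZl//; exact: integrableS (n_L1 u0).
Unshelve. all: end_near. Qed.

End time_cutoff.

Lemma integrable_itvoo (a b : R) (f : R -> R) : measurable_fun `[a, b] f ->
  mu.-integrable `]a, b[ (EFin \o f) -> mu.-integrable `[a, b] (EFin \o f).
Proof.
move=> mf iF; have mN : measurable ([set a; b] : set (measurableTypeR R)).
  by apply: measurableU; exact: measurable_set1.
apply: (negligible_integrable mN _ _ _).2 => //.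
- exact/measurable_EFinP.
- by rewrite measureU0//; exact: lebesgue_measure_set1.
- apply: integrableS iF => //; first exact: measurableD.
  move=> x [] /=; rewrite !in_itv/= => /andP[ax xb] /not_orP[/eqP xa /eqP xb'].
  by rewrite !lt_neqAle ax xb eq_sym xa xb'.
Qed.

Lemma tail_cvg (x u : R) : 0 <= x -> 0 <= u ->
  tail (n s) x @[s --> within [set s | 0 <= s] (nbhs u)] --> tail (n u) x.
Proof.
move=> x0 u0; apply/cvgrPdist_le => e e0.
have FF : Filter (within [set s | 0 <= s] (nbhs u)) by exact: within_filter.
have xoo : `]x, +oo[ `<=` `[0, +oo[.
  by move=> z; rewrite /= !in_itv/= !andbT => /ltW; apply: le_trans.
have mx : measurable (`]x, +oo[%classic : set (measurableTypeR R)) by exact: measurable_itv.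
have m0 : measurable (`[0, +oo[%classic : set (measurableTypeR R)) by exact: measurable_itv.
have f0 s : (0 <= \int[mu]_(z in `[0%R, +oo[) (`|n s z - n u z|)%:E)%E.
  by apply: integral_ge0 => z _; rewrite lee_fin.
have := cvge0_near_lt FF e0 f0 (n_cont u0).
rewrite !near_withinE; apply: filterS => s + s0 => /(_ s0) se; rewrite distrC.
have is_ : mu.-integrable `[0, +oo[ (EFin \o (fun z => n s z - n u z)).
  by apply: integrable_subr => //; exact: n_L1.
rewrite /tail -RintegralB//; [|exact: integrableS (n_L1 s0)|exact: integrableS (n_L1 u0)].
have isx : mu.-integrable `]x, +oo[ (EFin \o (fun z => n s z - n u z)).
  by apply: integrableS is_.
apply: (le_trans (le_normr_Rintegral mx isx)).
rewrite -lee_fin fineK; last by apply: integrable_fin_num => //; exact: integrable_norm isx.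
apply: le_trans (ltW se); apply: ge0_subset_integral => //.
exact: measurable_int (integrable_norm is_).
Qed.

Lemma tail_cvg_right x : 0 <= x -> tail (n s) x @[s --> 0^'+] --> tail (n 0) x.
Proof.
move=> x0; apply: cvg_trans (tail_cvg x0 (lexx 0)); apply: cvg_app => A.
change ((\forall s \near (0 : R), 0 <= s -> A s) -> \forall s \near (0 : R), 0 < s -> A s).
by apply: filterS => s As /ltW; exact: As.
Qed.

Lemma tail_cvg_left x : 0 <= x -> tail (n s) x @[s --> T^'-] --> tail (n T) x.
Proof.
move=> x0; apply: cvg_trans (tail_cvg x0 (ltW T0)); apply: cvg_app => A.
change ((\forall s \near T, 0 <= s -> A s) -> \forall s \near T, s < T -> A s).
move=> TA; near=> s => _; have : 0 <= s -> A s by near: s.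
by apply; rewrite ltW//; near: s; exact: lt_nbhsr.
Unshelve. all: end_near. Qed.

Lemma tail_integrable x : 0 <= x ->
  mu.-integrable `[0, T] (EFin \o (fun s => tail (n s) x)).
Proof.
move=> x0; apply: continuous_compact_integrable; first exact: segment_compact.
apply/subspace_continuousP => u /=; rewrite in_itv/= => /andP[u0 _].
apply: cvg_trans (tail_cvg x0 u0); apply: cvg_app => A.
change ((\forall s \near u, 0 <= s -> A s) -> \forall s \near u, s \in `[0, T] -> A s).
by apply: filterS => s As; rewrite in_itv/= => /andP[s0 _]; exact: As.
Qed.

Lemma flux_identity : {ae mu, forall x, 0 < x ->
  [/\ mu.-integrable `[0, T] (EFin \o (n^~ x)),
      mu.-integrable `[0, T] (EFin \o (fun t => n t x ^+ 2)),
      mu.-integrable `[0, T] (EFin \o (fun t => flux x (n t x))) &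
      \int[mu]_(t in `[0, T]) flux x (n t x) = tail (n T) x - tail (n 0) x]}.
Proof.
have mI : measurable (`[0, T]%classic : set (measurableTypeR R)) by exact: measurable_itv.
have mO : measurable (`]0, T[%classic : set (measurableTypeR R)) by exact: measurable_itv.
have m0 : measurable (`[0, +oo[%classic : set (measurableTypeR R)) by exact: measurable_itv.
pose e := T / 8; have e0 : 0 < e by rewrite divr_gt0.
pose h k := e / k.+1%:R.
have h0 k : 0 < h k by rewrite divr_gt0.
have he k : h k <= e by rewrite ler_pdivrMr// ler_peMr ?(ltW e0)// ler1n.
pose a k := time_cut T (h k).
have sa k : smooth (a k) by exact: smooth_cut.
have tT k : T - 2 * h k + h k < T by have := h0 k; move: (h k) => z; lra.
have hh k : h k + h k <= T - 2 * h k by have := he k; have := T0; rewrite /e; move: (h k) => z; lra.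
have a0 k u : u \notin `[h k, T - 2 * h k + h k] -> a k u = 0 by exact: cut_out.
have a01 k u : 0 <= a k u <= 1 by exact: cut_itv01.
have a1 k u : `|a k u| <= 1 by have /andP[? ?] := a01 k u; rewrite ger0_norm.
have ma k (D : set (measurableTypeR R)) : measurable D -> measurable_fun D (a k).
  by move=> mD; apply: continuous_measurable => //; exact: smooth_continuous.
have aeR : {ae mu, forall x, forall k, regular (a k) x}.
  by apply: ae_foralln => k; exact: (ae_regular (sa k) (h0 k) (tT k) (a0 k)).
have aeI : {ae mu, forall x, forall k j : nat, x \in `[j.+1%:R^-1, j.+1%:R] ->
    mu.-integrable `[0, T] (EFin \o (fun t => a k t * flux x (n t x)))}.
  apply: ae_foralln => k; apply: ae_foralln => j.
  have j0 : 0 < j.+1%:R^-1 :> R by rewrite invr_gt0.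
  have jj : j.+1%:R^-1 <= j.+1%:R :> R.
    by rewrite (@le_trans _ _ 1)// ?ler1n// invf_le1// ler1n.
  have mj : measurable (`[j.+1%:R^-1, j.+1%:R]%classic : set (measurableTypeR R)).
    exact: measurable_itv.
  exact: (fubini_ae_integrable2 mI mj (cut_flux_integrable2 n_int n_weak (sa k) (h0 k)
    (tT k) (a0 k) j0 jj)).
have aeN : {ae mu, forall x, x \in `[0, +oo[ -> mu.-integrable `[0, T] (EFin \o (n^~ x))}.
  exact: (fubini_ae_integrable2 mI m0 n_int).
move: aeR aeI aeN; apply: filterS3 => x rx ix nx x0.
have {}nx : mu.-integrable `[0, T] (EFin \o (n^~ x)).
  by apply: nx; rewrite in_itv/= ltW.
have {}ix k : mu.-integrable `[0, T] (EFin \o (fun t => a k t * flux x (n t x))).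
  pose j := maxn (Num.truncn (x^-1)) (Num.truncn x).
  apply: (ix k j); rewrite in_itv/=; apply/andP; split.
    rewrite -[leRHS]invrK lef_pV2 ?posrE ?invr_gt0//.
    by rewrite (le_trans (ltW (truncnS_gt _)))// ler_nat ltnS leq_maxl.
  by rewrite (le_trans (ltW (truncnS_gt _)))// ler_nat ltnS leq_maxr.
have mnx : measurable_fun `[0, T] (n^~ x) by exact: measurable_section (ltW x0).
have lim1 : cut_flux T n (a k) x @[k --> \oo] --> tail (n T) x - tail (n 0) x.
  rewrite (_ : (fun k => _) = fun k =>
      - \int[mu]_(u in `[0, T]) (derive1 (a k) u * tail (n u) x)); last first.
    apply/funext => k.
    exact: (cut_flux_tail (sa k) (h0 k) (tT k) (a0 k) (a1 k) x0 (rx k)).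
  rewrite -opprB; apply: cvgN.
  apply: (@cvg_at_right_seq _ e (fun h => \int[mu]_(u in `[0, T])
    (derive1 (time_cut T h) u * tail (n u) x)) _ e0).
  apply: (@cvg_derive1_time_cut _ _ (fun u => tail (n u) x)) => //.
  - exact: tail_integrable (ltW x0).
  - exact: tail_cvg_right (ltW x0).
  - exact: tail_cvg_left (ltW x0).
have [M [_ hM]] := cvg_seq_bounded (cvgP _ lim1).
pose c := 2 * x - x ^+ 2.
have ian k : mu.-integrable `[0, T] (EFin \o (fun t => a k t * n t x)).
  by apply: (@integrable_bounded_mul _ _ _ _ _ _ _ 1) => //; exact: ma.
have ican k : mu.-integrable `[0, T] (EFin \o (fun t => c * (a k t * n t x))).
  exact: integrable_mulr.
have n2E k t : a k t * n t x ^+ 2 = c * (a k t * n t x) - a k t * flux x (n t x).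
  by rewrite /flux -/c; ring.
have ian2 k : mu.-integrable `[0, T] (EFin \o (fun t => a k t * n t x ^+ 2)).
  have := integrable_subr mI (ican k) (ix k); congr integrable.
  by apply/funext => t; rewrite /= n2E.
have ito f : mu.-integrable `[0, T] (EFin \o f) -> mu.-integrable `]0, T[ (EFin \o f).
  by apply: integrableS => //; exact: subset_itv_oo_cc.
have RO f : mu.-integrable `[0, T] (EFin \o f) ->
    \int[mu]_(t in `]0, T[) f t = \int[mu]_(t in `[0, T]) f t.
  move=> fI; rewrite Rintegral_itv_bndo_bndc; last exact: ito.
  rewrite Rintegral_itv_obnd_cbnd//; apply: integrableS fI => //.
  exact: subset_itv_oc_cc.
have alim f t : `]0, T[%classic t -> a k t * f t @[k --> \oo] --> (f t : R).
  rewrite /= in_itv/= => tT'; rewrite -[X in _ --> X]mul1r; apply: cvgM; last exact: cvg_cst.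
  apply: (@cvg_at_right_seq _ e (fun h => time_cut T h t) _ e0).
  exact: cvg_time_cut.
(* Nothing is known on n ^ 2 near t = 0 and t = T: its integrability comes from
   Fatou's lemma and the boundedness of the cut fluxes [lim1]. *)
have in2 : mu.-integrable `[0, T] (EFin \o (fun t => n t x ^+ 2)).
  apply: integrable_itvoo; first exact: measurable_funX.
  pose M' := `|c| * \int[mu]_(t in `[0, T]) `|n t x| + (M + 1).
  apply: (@Rintegral_fatou _ _ _ mu _ (fun k t => a k t * n t x ^+ 2) _ M') => //.
  - by move=> k; exact: ito.
  - by move=> k t _; rewrite mulr_ge0 ?sqr_ge0//; have /andP[] := a01 k t.
  - by move=> t; exact: (alim (fun t => n t x ^+ 2)).
  - move=> k; rewrite RO//; under eq_Rintegral do rewrite n2E.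
    rewrite RintegralB// RintegralZl// /M'; apply: lerD.
      apply: le_trans (ler_norm _) _; rewrite normrM ler_wpM2l//.
      apply: (le_trans (le_normr_Rintegral mI (ian k))).
      apply: le_Rintegral => //; [exact: integrable_norm (ian k)|exact: integrable_norm nx|].
      by move=> t _; rewrite normrM ler_piMl.
    apply: le_trans (ler_norm _) _; rewrite normrN.
    by apply: (hM (M + 1)) => //; rewrite ltrDl.
have iF : mu.-integrable `[0, T] (EFin \o (fun t => flux x (n t x))).
  by apply: integrable_subr => //; exact: integrable_mulr.
split => //; rewrite -RO//.
have [|||||_ lim2] := @Rintegral_dominated _ _ _ mu `]0%R, T[%classic
  (fun k t => a k t * flux x (n t x)) (fun t => flux x (n t x))
  (fun t => `|flux x (n t x)|).
- exact: measurable_itv.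
- by move=> k; apply/measurable_EFinP; exact: measurable_int (ito _ (ix k)).
- by move=> t; exact: (alim (fun t => flux x (n t x))).
- exact: integrable_norm (ito _ iF).
- by move=> k t _; rewrite normrM ler_piMl.
have E : (fun k => \int[mu]_(t in `]0, T[) (a k t * flux x (n t x))) =
    (fun k => cut_flux T n (a k) x).
  by apply/funext => k; exact: RO (ix k).
rewrite E in lim2; exact: (norm_cvg_unique lim2 lim1).
Qed.

End flux_identity.

(** * Loss of mass *)

Lemma ae_le_Rintegral d (X : measurableType d) (R : realType)
    (nu : {measure set X -> \bar R}) (D : set X) (f g : X -> R) : measurable D ->
  nu.-integrable D (EFin \o f) -> nu.-integrable D (EFin \o g) ->
  {ae nu, forall x, D x -> f x <= g x} ->
  Rintegral nu D f <= Rintegral nu D g.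
Proof.
move=> mD iF iG fg; have iGF := integrable_subr mD iG iF.
rewrite -subr_ge0 -RintegralB// (@ae_eq_Rintegral _ _ _ _ _ _ (fun x => `|g x - f x|))//.
- by apply: Rintegral_ge0 => x _; exact: normr_ge0.
- exact: integrable_norm iGF.
- by apply: filterS fg => x fgx Dx; rewrite ger0_norm// subr_ge0 fgx.
Qed.

Lemma ae_Rintegral_ge0 d (X : measurableType d) (R : realType)
    (nu : {measure set X -> \bar R}) (D : set X) (f : X -> R) : measurable D ->
  nu.-integrable D (EFin \o f) -> {ae nu, forall x, D x -> 0 <= f x} ->
  0 <= Rintegral nu D f.
Proof.
move=> mD iF f0; have -> : 0 = Rintegral nu D (cst (0 : R)).
  by rewrite Rintegral_cst// mul0r.
by apply: ae_le_Rintegral => //; exact: (@integrable0 _ _ _ nu).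
Qed.

Section product_ae.
Context d1 d2 (X : measurableType d1) (Y : measurableType d2) {R : realType}.
Context (m1 : {sigma_finite_measure set X -> \bar R})
  (m2 : {sigma_finite_measure set Y -> \bar R}).

Lemma ae_product_sections (P : X * Y -> Prop) :
  {ae (m1 \x m2)%E, forall p, P p} ->
  {ae m1, forall x, {ae m2, forall y, P (x, y)}} /\
  {ae m2, forall y, {ae m1, forall x, P (x, y)}}.
Proof.
move=> [N [mN N0 PN]].
have I0 : (\int[m1]_x (m2 \o xsection N) x = 0)%E by rewrite -N0.
have J0 : (\int[m2]_y (m1 \o ysection N) y = 0)%E.
  have := indic_fubini_tonelli m1 m2 mN.
  rewrite indic_fubini_tonelli_FE// indic_fubini_tonelli_GE// => <-.
  exact: I0.
split.
- have /(ae_eq_integral_abs m1 measurableT _).1 : (\int[m1]_x `|(m2 \o xsection N) x| = 0)%E.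
    by rewrite -[RHS]I0; apply: eq_integral => x _; rewrite gee0_abs.
  move=> /(_ (measurable_fun_xsection m2 mN)); apply: filterS => x /(_ I)/= Nx.
  exists (xsection N x); split => //; first exact: measurable_xsection.
  by move=> y /= Pxy; rewrite xsectionE/=; exact: PN.
- have /(ae_eq_integral_abs m2 measurableT _).1 : (\int[m2]_y `|(m1 \o ysection N) y| = 0)%E.
    by rewrite -[RHS]J0; apply: eq_integral => y _; rewrite gee0_abs.
  move=> /(_ (measurable_fun_ysection m1 mN)); apply: filterS => y /(_ I)/= Ny.
  exists (ysection N y); split => //; first exact: measurable_ysection.
  by move=> x /= Pxy; rewrite ysectionE/=; exact: PN.
Qed.

End product_ae.

Section tails.
Context {R : realType}.
Local Notation mu := (@lebesgue_measure R).
Implicit Types u f : R -> R.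

Lemma integrable_tail u x : 0 <= x -> mu.-integrable `[0, +oo[ (EFin \o u) ->
  mu.-integrable `]x, +oo[ (EFin \o u).
Proof.
move=> x0; apply: integrableS => //.
by move=> z; rewrite /= !in_itv/= !andbT => /ltW; apply: le_trans.
Qed.

Lemma massE u : mu.-integrable `[0, +oo[ (EFin \o u) -> mass u = (tail u 0)%:E.
Proof.
move=> iu; rewrite /tail Rintegral_itv_obnd_cbnd; last first.
  exact: integrable_tail.
by rewrite fineK//; exact: integrable_fin_num.
Qed.

Lemma normr_tail_le u x : 0 <= x -> mu.-integrable `[0, +oo[ (EFin \o u) ->
  `|tail u x| <= \int[mu]_(z in `[0, +oo[) `|u z|.
Proof.
move=> x0 iu; have iux := integrable_tail x0 iu.
have mx : measurable (`]x, +oo[%classic : set (measurableTypeR R)) by exact: measurable_itv.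
apply: (le_trans (le_normr_Rintegral mx iux)).
rewrite -lee_fin !fineK ?integrable_fin_num//; try exact: integrable_norm.
apply: ge0_subset_integral => //.
- exact: measurable_int (integrable_norm iu).
- by move=> z; rewrite /= !in_itv/= !andbT => /ltW; apply: le_trans.
Qed.

Lemma tail_cvg_at0 u : mu.-integrable `[0, +oo[ (EFin \o u) ->
  tail u x @[x --> 0^'+] --> tail u 0.
Proof.
move=> iu; have i01 : mu.-integrable `[0, 1] (EFin \o u).
  by apply: integrableS iu => //; apply: subset_itvl.
have p0 := parameterized_integral_cvg_left ltr01 i01.
have lim : tail u 0 - parameterized_integral mu 0 x u @[x --> 0^'+] --> tail u 0 - 0.
  by apply: cvgB; [exact: cvg_cst|exact: cvg_at_right_filter].
rewrite subr0 in lim; apply: cvg_trans lim; apply: near_eq_cvg.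
near=> x; have x0 : 0 < x by [].
have iu0 := integrable_tail (lexx 0) iu.
have := @Rintegral_itvB _ u (BRight 0) +oo%O x iu0.
rewrite /tail /parameterized_integral => <-//; last by rewrite bnd_simp ltW.
congr (_ - _); rewrite Rintegral_itv_obnd_cbnd//.
apply: integrableS iu => // z; rewrite /= !in_itv/= andbT => /andP[/ltW//].
Unshelve. all: end_near. Qed.

End tails.

Section mass_loss.
Context {R : realType}.
Local Notation mu := (@lebesgue_measure R).

(* The tangent at [c] of the concave function [flux x] lies above it; [c] is
   [hat_n0 x + h] for [x <= 3] and [0] for [x > 3]. *)
Lemma time_integral_le (T A h x : R) (u : R -> R) : 0 < T -> 0 < h -> 0 <= A -> 0 < x ->
  mu.-integrable `[0, T] (EFin \o u) ->
  mu.-integrable `[0, T] (EFin \o (fun t => flux x (u t))) ->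
  0 <= \int[mu]_(t in `[0, T]) u t ->
  - A <= \int[mu]_(t in `[0, T]) flux x (u t) ->
  \int[mu]_(t in `[0, T]) u t <=
    T * hat_n0 x + (5 * (A + T * h ^+ 2) / h + 6 * A) * (oneDsqr x)^-1.
Proof.
move=> T0 h0 A0 x0 iu iF; set V := \int[mu]_(t in `[0, T]) u t => V0 FA.
have mI : measurable (`[0, T]%classic : set (measurableTypeR R)) by exact: measurable_itv.
have Ifin : (mu `[0%R, T]%classic < +oo)%E.
  by rewrite lebesgue_measure_itv/= lte_fin T0 oppr0 adde0 ltry.
have tangent c : - A <= (2 * x - x ^+ 2 - 2 * c) * V + c ^+ 2 * T.
  apply: (le_trans FA).
  have ic : mu.-integrable `[0, T] (EFin \o cst (c ^+ 2)) by exact: integrable_cst_lty.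
  have iU : mu.-integrable `[0, T] (EFin \o (fun t => (2 * x - x ^+ 2 - 2 * c) * u t)).
    exact: integrable_mulr.
  apply: (@le_trans _ _ (\int[mu]_(t in `[0, T])
      ((2 * x - x ^+ 2 - 2 * c) * u t + c ^+ 2))).
    apply: le_Rintegral => //; first exact: integrable_addr.
    by move=> t _; have := sqr_ge0 (u t - c); rewrite /flux; nra.
  rewrite RintegralD// RintegralZl// Rintegral_cst//= lebesgue_measure_itv/= lte_fin.
  by rewrite T0 oppr0 adde0.
have H0 : 0 <= hat_n0 x by rewrite /hat_n0 le_max lexx orbT.
have Hx : 2 * x - x ^+ 2 <= hat_n0 x by rewrite /hat_n0 le_max lexx.
have w0 : 0 < oneDsqr x by rewrite (lt_le_trans ltr01)// oneDsqr_ge1.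
have B0 : 0 <= 5 * (A + T * h ^+ 2) / h.
  by rewrite divr_ge0 ?(ltW h0)// mulr_ge0// addr_ge0// mulr_ge0 ?sqr_ge0// ltW.
have [x3|x3] := leP x 3.
- have w10 : 1 <= 10 * (oneDsqr x)^-1 by rewrite ler_pdivlMr// /oneDsqr; nra.
  have key : V - T * hat_n0 x <= (A + T * h ^+ 2) / (2 * h).
    rewrite ler_pdivlMr ?mulr_gt0//.
    have := tangent (hat_n0 x + h); set H := hat_n0 x in H0 Hx *.
    set q := 2 * x - x ^+ 2 in Hx * => tg.
    have qV : 0 <= (H - q) * V by rewrite mulr_ge0// subr_ge0.
    have s1 : (2 * h + H) * (V - T * H) <= A + T * h ^+ 2.
      by move: tg qV; rewrite !expr2 => tg qV; nra.
    have Ah : 0 <= A + T * h ^+ 2 by rewrite addr_ge0// mulr_ge0 ?sqr_ge0// ltW.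
    have [VT|VT] := leP V (T * H).
      by apply: le_trans Ah; rewrite mulr_le0_ge0 ?subr_le0// mulr_ge0// ltW.
    apply: le_trans s1; rewrite mulrC ler_wpM2r ?subr_ge0 ?(ltW VT)//.
    by rewrite lerDl.
  set B := 5 * (A + T * h ^+ 2) / h in B0 *.
  have BE : (A + T * h ^+ 2) / (2 * h) = B / 10 by rewrite /B; field; rewrite gt_eqF.
  rewrite BE in key.
  have : 0 <= A * (oneDsqr x)^-1 by rewrite mulr_ge0// invr_ge0 ltW.
  have : B / 10 * 1 <= B / 10 * (10 * (oneDsqr x)^-1).
    by rewrite ler_wpM2l// divr_ge0.
  move: (oneDsqr x)^-1 key => w key b1 b2; clear -key b1 b2.
  by move: (T * _) key => TH key; lra.
- have := tangent 0; rewrite mulr0 subr0 expr0n mul0r addr0 => t0.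
  have BW : 0 <= 5 * (A + T * h ^+ 2) / h * (oneDsqr x)^-1.
    by rewrite mulr_ge0// invr_ge0 ltW.
  have TH : 0 <= T * hat_n0 x by rewrite mulr_ge0// ltW.
  have : V <= 6 * A * (oneDsqr x)^-1.
    rewrite ler_pdivlMr// /oneDsqr.
    have : V * (1 + x ^+ 2) <= V * (6 * (x ^+ 2 - 2 * x)).
      rewrite ler_wpM2l//; have : 0 <= x * (x - 3).
        by rewrite mulr_ge0 ?subr_ge0 ?(ltW x0) ?(ltW x3).
      by move: x3; clear; rewrite !expr2 => x3 xx; lra.
    by lra.
  by rewrite mulrDl; lra.
Qed.

End mass_loss.

Section global.
Context {R : realType}.
Local Notation mu := (@lebesgue_measure R).
Variables (n : R -> R -> R).
Hypothesis n_sol : global_entropy_solution n.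
Hypothesis n_ge0 : {ae (mu \x mu)%E, forall p, 0 < p.1 -> 0 < p.2 -> 0 <= n p.1 p.2}.
Hypothesis n_L1 : forall t, 0 <= t -> mu.-integrable `[0, +oo[ (EFin \o n t).
Hypothesis n_cont : forall t, 0 <= t ->
  (\int[mu]_(x in `[0%R, +oo[) (`|n s x - n t x|)%:E)%E
    @[s --> within [set s | 0 <= s] (nbhs t)] --> 0%E.

Lemma global_flux_identity T : 0 < T -> {ae mu, forall x, 0 < x ->
  [/\ mu.-integrable `[0, T] (EFin \o (n^~ x)),
      mu.-integrable `[0, T] (EFin \o (fun t => n t x ^+ 2)),
      mu.-integrable `[0, T] (EFin \o (fun t => flux x (n t x))) &
      \int[mu]_(t in `[0, T]) flux x (n t x) = tail (n T) x - tail (n 0) x]}.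
Proof. by move=> T0; have [i _ w _ f] := n_sol T0; exact: flux_identity. Qed.

Lemma mass_decreases (m : R) : mass (@hat_n0 R) = m%:E -> m < tail (n 0) 0 ->
  exists2 T, 0 < T & tail (n T) 0 < tail (n 0) 0.
Proof.
move=> hatm mM; apply: contrapT => noT.
have M_le T : 0 < T -> tail (n 0) 0 <= tail (n T) 0.
  by move=> T0; rewrite leNgt; apply/negP => h; apply: noT; exists T.
have [aeT aeX] := ae_product_sections n_ge0.
pose M := tail (n 0) 0; pose D := M - m; pose W : R := pi / 2.
have D0 : 0 < D by rewrite subr_gt0.
have W0 : 0 < W by rewrite divr_gt0// pi_gt0.
pose h := D / (10 * W); have h0 : 0 < h by rewrite divr_gt0// mulr_gt0.
pose A := \int[mu]_(x in `[0, +oo[) `|n 0 x|.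
have A0 : 0 <= A by apply: Rintegral_ge0 => x _.
pose K := (5 * A / h + 6 * A) * W.
have K0 : 0 <= K.
  by rewrite mulr_ge0 ?(ltW W0)// addr_ge0 ?mulr_ge0// invr_ge0 ltW.
have [T [TK _ nT]] : exists T, [/\ 2 * K / D < T, T < 2 * K / D + 1 &
    {ae mu, forall x, 0 < T -> 0 < x -> 0 <= n T x}].
  by apply: ae_exists_itv aeT; rewrite ltrDl.
have T0 : 0 < T by rewrite (le_lt_trans _ TK)// divr_ge0 ?(ltW D0)// mulr_ge0.
have mI : measurable (`[0, T]%classic : set (measurableTypeR R)) by exact: measurable_itv.
have mO : measurable (`]0, +oo[%classic : set (measurableTypeR R)) by exact: measurable_itv.
have m0 : measurable (`[0, +oo[%classic : set (measurableTypeR R)) by exact: measurable_itv.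
have tT x : 0 < x -> 0 <= tail (n T) x.
  move=> x0; have mx : measurable (`]x, +oo[%classic : set (measurableTypeR R)).
    exact: measurable_itv.
  apply: ae_Rintegral_ge0 => //.
  - exact: integrable_tail (ltW x0) (n_L1 (ltW T0)).
  - move: nT; apply: filterS => z /(_ T0) nz; rewrite /= in_itv/= andbT => xz.
    by apply: nz; exact: lt_trans xz.
have [n_int _ _ _ _] := n_sol T0.
pose v x := \int[mu]_(t in `[0, T]) n t x.
pose w x : R := (oneDsqr x)^-1.
pose Q := 5 * (A + T * h ^+ 2) / h + 6 * A.
have n_int0 : (mu \x mu)%E.-integrable (`[0, T] `*` `]0, +oo[) (EFin \o (fun p => n p.1 p.2)).
  apply: integrableS n_int; [exact: measurableX|exact: measurableX|].
  move=> p [p1 p2]; split => //; move: p2; rewrite /= !in_itv/= !andbT; exact: ltW.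
have iv : mu.-integrable `]0, +oo[ (EFin \o v).
  exact: (fubini_integrable2 mI mO n_int0).
have w_ge0 x : 0 <= w x by rewrite invr_ge0 (le_trans ler01)// oneDsqr_ge1.
have iw0 : mu.-integrable `[0, +oo[ (EFin \o w).
  apply/integrableP; split.
    apply/measurable_EFinP; apply: continuous_measurable => // x.
    exact: continuous_oneDsqrV.
  under eq_integral do rewrite /= ger0_norm//.
  by rewrite integral0y_oneDsqr ltry.
have ih0 : mu.-integrable `[0, +oo[ (EFin \o @hat_n0 R).
  apply/integrableP; split.
    apply/measurable_EFinP/measurable_funTS/measurable_maxr => //.
    by apply: continuous_measurable => //; exact: continuous_quad.
  under eq_integral => x _.
    by rewrite /= ger0_norm; [over|rewrite /hat_n0 le_max lexx orbT].
  by rewrite -/(mass _) hatm ltry.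
have iw : mu.-integrable `]0, +oo[ (EFin \o w).
  exact: integrable_tail (lexx 0) iw0.
have ih : mu.-integrable `]0, +oo[ (EFin \o @hat_n0 R).
  exact: integrable_tail (lexx 0) ih0.
have v_le : {ae mu, forall x, `]0, +oo[%classic x -> v x <= T * hat_n0 x + Q * w x}.
  move: aeX (global_flux_identity T0); apply: filterS2 => x nx fx.
  rewrite /= in_itv/= andbT => x0; have [ix _ iF FE] := fx x0.
  apply: time_integral_le => //.
    apply: ae_Rintegral_ge0 => //; have : {ae mu, forall t : R, t != 0}.
      exists [set 0]; split; [exact: measurable_set1|exact: lebesgue_measure_set1|].
      by move=> t /= /negP; rewrite negbK => /eqP.
    move: nx; apply: filterS2 => t nt t0; rewrite /= in_itv/= => /andP[t_ge0 _].
    by apply: nt => //; rewrite /= lt_neqAle eq_sym t0.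
  rewrite FE; have := tT _ x0; have := normr_tail_le (ltW x0) (n_L1 (lexx 0)).
  by rewrite -/A ler_norml => /andP[? ?] ?; lra.
have iQw : mu.-integrable `]0, +oo[ (EFin \o (fun x => Q * w x)) by exact: integrable_mulr.
have iTh : mu.-integrable `]0, +oo[ (EFin \o (fun x => T * hat_n0 x)) by exact: integrable_mulr.
have hat0 : \int[mu]_(x in `]0, +oo[) hat_n0 x = m.
  by apply: EFin_inj; rewrite -hatm (massE ih0).
have wW : \int[mu]_(x in `]0, +oo[) w x = W.
  by apply: EFin_inj; rewrite -[RHS](integral0y_oneDsqr R) -(massE iw0).
have TM : T * M <= T * m + Q * W.
  have -> : T * M = \int[mu]_(t in `[0, T]) (cst M t).
    rewrite Rintegral_cst//= lebesgue_measure_itv/= lte_fin T0 oppr0 adde0/=.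
    by rewrite mulrC.
  rewrite -hat0 -wW -RintegralZl// -[in X in _ <= _ + X]RintegralZl// -RintegralD//.
  apply: (@le_trans _ _ (\int[mu]_(x in `]0, +oo[) v x)).
    rewrite -(fubini_Rintegral2 mI mO n_int0) (fubini_Rintegral1 mI mO n_int0).
    apply: le_Rintegral => //.
    - apply: integrable_cst_lty => //.
      by rewrite lebesgue_measure_itv/= lte_fin T0 oppr0 adde0 ltry.
    - exact: (tail_integrable T n_L1 n_cont (lexx 0)).
    - move=> t; rewrite /= in_itv/= => /andP[+ _]; rewrite le_eqVlt => /predU1P[<-//|].
      exact: M_le.
  by apply: ae_le_Rintegral => //; exact: integrable_addr.
have QW : Q * W = K + T * D / 2.
  by rewrite /Q /K /h; field; rewrite !gt_eqF.
have TD : T * M = T * m + T * D by rewrite -mulrDr /D addrC subrK.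
rewrite TD QW lerD2l in TM; rewrite ltr_pdivrMr// in TK.
have : forall a b : R, a <= b + a / 2 -> 2 * b < a -> False by move=> a b; lra.
by move=> /(_ _ _ TM TK).
Qed.

End global.

Section outflux.
Context {R : realType}.
Local Notation mu := (@lebesgue_measure R).
Variables (n : R -> R -> R).
Hypothesis n_sol : global_entropy_solution n.
Hypothesis n_L1 : forall t, 0 <= t -> mu.-integrable `[0, +oo[ (EFin \o n t).
Hypothesis n_cont : forall t, 0 <= t ->
  (\int[mu]_(x in `[0%R, +oo[) (`|n s x - n t x|)%:E)%E
    @[s --> within [set s | 0 <= s] (nbhs t)] --> 0%E.
Variable T : R.
Hypothesis T0 : 0 < T.

Let J := tail (n 0) 0 - tail (n T) 0.

Lemma near_outflux (e : R) : 0 < e -> exists2 h : R, 0 < h & {ae mu, forall x,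
  0 < x < h -> [/\ mu.-integrable `[0, T] (EFin \o (fun t => n t x ^+ 2)),
    mu.-integrable `[0, T] (EFin \o (fun t => - flux x (n t x))) &
    `|\int[mu]_(t in `[0, T]) - flux x (n t x) - J| < e]}.
Proof.
move=> e0; have mI : measurable (`[0, T]%classic : set (measurableTypeR R)).
  exact: measurable_itv.
have lim : tail (n 0) x - tail (n T) x @[x --> 0^'+] --> J.
  by apply: cvgB; apply: tail_cvg_at0; apply: n_L1 => //; exact: ltW.
move/cvgrPdist_lt : lim => /(_ _ e0)/near_at_right[h h0 H].
exists h => //; have := global_flux_identity n_sol n_L1 n_cont T0.
apply: filterS => x fx /andP[x0 xh]; have [_ i2 iF FE] := fx x0.
have NE : (fun t => - flux x (n t x)) = (fun t => -1 * flux x (n t x)).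
  by apply/funext => t; rewrite mulN1r.
split => //; first by rewrite NE; exact: integrable_mulr.
rewrite NE RintegralZl// FE mulN1r opprB distrC -[x]add0r; exact: H.
Qed.

Lemma outflux_eq : total_outflux T n J.
Proof.
move=> e e0; have [h h0 aeh] := near_outflux e0.
have mI : measurable (`[0, T]%classic : set (measurableTypeR R)) by exact: measurable_itv.
exists [set x | 0 < x < h].
  by apply: (@at_right_near _ _ _ h) => // y y0 yh; rewrite add0r /= y0.
move: aeh; apply: filterS => x hx /hx[_ iF].
by rewrite -lte_fin -(fineK (integrable_fin_num mI iF)) -EFinB.
Qed.

Lemma outflux_trace g : trace T n 0^'+ g ->
  (\int[mu]_(t in `[0%R, T]) (g t ^+ 2)%:E = J%:E)%E.
Proof.
move=> tr; have mg := tr.1.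
have mI : measurable (`[0, T]%classic : set (measurableTypeR R)) by exact: measurable_itv.
have [n_int _ _ _ _] := n_sol T0.
have pick (P : R -> Prop) (A : set R) (h : R) : 0 < h -> 0^'+ A ->
    {ae mu, forall x, P x} -> exists x, [/\ 0 < x < h, A x & P x].
  move=> h0 A0 aeP; have [h' h'0 H] := near_at_right A0.
  have [x [x0 xm Px]] : exists x, [/\ 0 < x, x < Num.min h h' & P x].
    by apply: ae_exists_itv => //; rewrite lt_min h0.
  exists x; move: xm; rewrite lt_min => /andP[xh xh']; split => //.
    by rewrite x0.
  by rewrite -[x]add0r; exact: H.
have ig2 : mu.-integrable `[0, T] (EFin \o (fun t => g t ^+ 2)).
  have [A A0 aeA] := tr.2 1 ltr01; have [h h0 aeh] := near_outflux ltr01.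
  have [x [xh Ax [hx aex]]] := pick _ A h h0 A0 (filterI aeh aeA).
  have [i2 _ _] := hx xh; have {}aex := aex Ax; move: (xh) => /andP[x0 _].
  apply: (integrable_sqr_of_close mI mg i2).
  have mx := measurable_section n_int (ltW x0).
  apply/integrableP; split.
    by apply/measurable_EFinP/measurable_funX; exact: measurable_funB.
  under eq_integral do rewrite /= ger0_norm ?sqr_ge0//.
  exact: lt_trans aex (ltry _).
rewrite -(fineK (integrable_fin_num mI ig2)); congr EFin.
apply/eqP; rewrite -subr_eq0 -normr_le0; apply/ler_addgt0Pl => e e0; rewrite addr0.
have e20 : 0 < e / 2 by rewrite divr_gt0.
have G0 : (0 : R)^'+ `=>` nbhs 0 by exact: cvg_within.
have mG : \forall x \near 0^'+, measurable_fun `[0, T] (n^~ x).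
  near=> x; apply: (measurable_section n_int); near: x; exact: nbhs_right_ge.
have [A A0 aeA] := trace_flux T0 _ G0 mG tr ig2 e20.
have [h h0 aeh] := near_outflux e20.
have [x [xh Ax [hx aex]]] := pick _ A h h0 A0 (filterI aeh aeA).
have [_ iF dJ] := hx xh; have [_ iF' dg] := aex Ax.
set I2 := fine _; pose IF := \int[mu]_(t in `[0, T]) - flux x (n t x).
have -> : I2 - J = - (IF - I2) + (IF - J) by ring.
rewrite (le_trans (ler_normD _ _))// (splitr e) lerD ?(ltW dJ)// normrN.
apply: le_trans dg; rewrite /IF /I2 -RintegralB//.
have id : mu.-integrable `[0, T] (EFin \o (fun t => - flux x (n t x) - g t ^+ 2)).
  exact: integrable_subr.
apply: (le_trans (le_normr_Rintegral mI id)); rewrite le_eqVlt; apply/orP; left.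
apply/eqP; apply: eq_Rintegral => t _; rewrite -normrN; congr `|_|.
by rewrite /flux; ring.
Unshelve. all: end_near. Qed.

End outflux.

Theorem corollary1p3 (R : realType) (n : R -> R -> R) (n0 : R -> R)
  (n_sol : global_entropy_solution n)
  (n_ge0 : {ae (@lebesgue_measure R \x @lebesgue_measure R)%E,
              forall p, 0 < p.1 -> 0 < p.2 -> 0 <= n p.1 p.2})
  (n0_L1 : (@lebesgue_measure R).-integrable `[0, +oo[ (EFin \o n0))
  (n_init : initial_data n n0)
  (n0_supp : compactly_supported n0)
  (n0_mass : (mass (@hat_n0 R) < mass n0)%E) :
  exists T : R, [/\ 0 < T,
    (mass (n T) < mass n0)%E &
    exists J : R, [/\ 0 < J,
      total_outflux T n J &
      forall g : R -> R, trace T n 0^'+ g ->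
        (\int[@lebesgue_measure R]_(t in `[0%R, T]) (g t ^+ 2)%:E = J%:E)%E]].
Proof.
have [n_L1 n_cont n_0] := n_init.
have mass_n0 : mass n0 = (tail (n 0) 0)%:E.
  rewrite -massE; last exact: n_L1.
  apply: ae_eq_integral => //.
  - exact: measurable_int n0_L1.
  - exact: measurable_int (n_L1 0 (lexx 0)).
  - move: n_0; apply: filterS => x nx; rewrite /= in_itv/= andbT => x0.
    by rewrite nx.
have hat_fin : mass (@hat_n0 R) = (fine (mass (@hat_n0 R)))%:E.
  rewrite fineK// ge0_fin_numE.
    by apply: lt_trans n0_mass _; rewrite mass_n0 ltry.
  by apply: integral_ge0 => x _; rewrite lee_fin /hat_n0 le_max lexx orbT.
have lt0 : fine (mass (@hat_n0 R)) < tail (n 0) 0.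
  by rewrite -lte_fin -hat_fin -mass_n0.
have [T T0 lossT] := mass_decreases n_sol n_ge0 n_L1 n_cont hat_fin lt0.
exists T; split => //.
  by rewrite mass_n0 massE ?lte_fin//; apply: n_L1; exact: ltW.
exists (tail (n 0) 0 - tail (n T) 0); split; first by rewrite subr_gt0.
- exact: outflux_eq.
- by move=> g; exact: outflux_trace.
Qed.
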